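(* Let $\pi : Y \to X$ be a finite morphism between affine complex varieties. Then the following properties are equivalent: 1) $\pi$ is subintegral. 2) $\pi_{\mathbb{C}} : Y(\mathbb{C}) \to X(\mathbb{C})$ is bijective. 3) The map $f \mapsto f\circ \pi_{\mathbb{C}}$ is a ring isomorphism from $\mathcal{K}^0(X(\mathbb{C}))$ onto $\mathcal{K}^0(Y(\mathbb{C}))$. 4) $\pi_{\mathbb{C}}$ is a homeomorphism for the Euclidean topology. 5) $\pi_{\mathbb{C}}$ is a homeomorphism for the Zariski topology. 6) $\pi$ is a homeomorphism (for the Zariski topologies of the spectra $Y$ and $X$).
   Context: An affine complex variety is $X=\operatorname{Spec}(\mathbb{C}[X])$ with $\mathbb{C}[X]$ a reduced finitely generated $\mathbb{C}$-algebra ($X$ need not be irreducible). $X(\mathbb{C})$ is the set of closed points of $X$, identified with a Zariski closed subset of some $\mathbb{C}^n$; elements of $\mathbb{C}[X]$ are identified with polynomial functions on $X(\mathbb{C})$. A morphism $\pi:Y\to X$ induces $\pi^*:\mathbb{C}[X]\to\mathbb{C}[Y]$; it is finite if $\pi^*$ makes $\mathbb{C}[Y]$ a finite $\mathbb{C}[X]$-module. $\pi_{\mathbb{C}}$ is the restriction of $\pi$ to $Y(\mathbb{C})\to X(\mathbb{C})$. A function $f:X(\mathbb{C})\to\mathbb{C}$ is rational if it is regular on some Zariski dense Zariski open subset of $X(\mathbb{C})$. $\mathcal{K}^0(X(\mathbb{C}))$ is the ring of functions $f:X(\mathbb{C})\to\mathbb{C}$ that are rational and continuous on all of $X(\mathbb{C})$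 for the Euclidean topology. An integral extension of rings $A\hookrightarrow B$ is subintegral if the induced map $\operatorname{Spec}(B)\to\operatorname{Spec}(A)$ is bijective and, for all $\mathfrak{q}\in\operatorname{Spec}(B)$ with $\mathfrak{p}=\mathfrak{q}\cap A$, the induced map of residue fields $\kappa(\mathfrak{p})\to\kappa(\mathfrak{q})$ is an isomorphism. The morphism $\pi$ is subintegral if $\pi^*$ is injective and the extension $\pi^*:\mathbb{C}[X]\hookrightarrow\mathbb{C}[Y]$ is subintegral. *)

(* Defs.v *)
From HB Require Import structures.
From mathcomp Require Import all_boot all_order all_algebra generic_quotient.
From mathcomp Require Import ring complex.
From mathcomp Require Import all_classical all_reals all_analysis.

Set Implicit Arguments.
Unset Strict Implicit.
Unset Printing Implicit Defensive.

Import Order.TTheory GRing.Theory Num.Theory.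
Import numFieldNormedType.Exports.
Local Open Scope classical_set_scope.
Local Open Scope quotient_scope.
Local Open Scope ring_scope.

(* Rings are only assumed to be comPzRingType, because the coordinate ring of *)
(* the empty variety is the zero ring.                                        *)

Record spec (A : comPzRingType) := Spec {
  spec_set :> A -> Prop;
  spec0 : spec_set 0;
  specD : forall a b, spec_set a -> spec_set b -> spec_set (a + b);
  specMl : forall a b, spec_set b -> spec_set (a * b);
  specN1 : ~ spec_set 1;
  specM : forall a b, spec_set (a * b) -> spec_set a \/ spec_set b }.

Lemma spec_ext (A : comPzRingType) (p q : spec A) :
  (forall a, p a <-> q a) -> p = q.
Proof.
case: p q => [P p0 pD pM p1 pp] [Q q0 qD qM q1 qp] /= PQ.
have PQE : P = Q by apply/funext => a; apply/propext.
by subst Q; congr Spec; exact: Prop_irrelevance.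
Qed.

HB.instance Definition _ (A : comPzRingType) := gen_eqMixin (spec A).
HB.instance Definition _ (A : comPzRingType) := gen_choiceMixin (spec A).

Section SpecTopology.
Variable A : comPzRingType.

(* The vanishing locus of S is the set of primes containing S. *)
Definition spec_open : set (set (spec A)) :=
  [set U | exists S : set A, U = ~` [set p : spec A | forall a, S a -> p a]].

Lemma spec_openT : spec_open setT.
Proof.
exists setT; apply/esym/seteqP; split=> // p _ /= pT.
by apply: (@specN1 _ p); exact: pT.
Qed.

Lemma spec_openI : setI_closed spec_open.
Proof.
move=> _ _ [S ->] [T ->]; exists [set a * b | a in S & b in T].
apply/seteqP; split=> p /=.
  move=> [nSp nTp] STp.
  have /existsNP [a /not_implyP [Sa npa]] := nSp.
  have /existsNP [b /not_implyP [Tb npb]] := nTp.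
  have /specM [//|//] : p (a * b) by apply: STp; exists a => //; exists b.
move=> nST; split=> sub; apply: nST => _ [a Sa [b Tb <-]].
  by rewrite mulrC; exact/specMl/sub.
exact/specMl/sub.
Qed.

Lemma spec_open_bigU (I : Type) (f : I -> set (spec A)) :
  (forall i, spec_open (f i)) -> spec_open (\bigcup_i f i).
Proof.
move=> /choice [S fE]; exists (\bigcup_i S i); apply/seteqP; split=> p /=.
  move=> [i _]; rewrite fE /= => nS sub; apply: nS => a Sa.
  by apply: sub; exists i.
move=> nsub; apply: contrapT => nU; apply: nsub => a [i _ Sia].
apply: contrapT => npa; apply: nU; exists i => //; rewrite fE /= => sub.
exact/npa/sub.
Qed.

HB.instance Definition _ :=
  isOpenTopological.Build (spec A) spec_openT spec_openI spec_open_bigU.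

End SpecTopology.

(* The residue field of p, i.e. the fraction field of A / p: classes of       *)
(* fractions a / s with s outside p, where a / s = b / t iff a t - b s \in p. *)
Section ResidueField.
Variables (A : comPzRingType) (p : spec A).

Definition resfrac := {x : A * A | `[< ~ p x.2 >]}.

Implicit Types x y z : resfrac.

Lemma resfracP x : ~ p (val x).2.
Proof. by case: x => x /= /asboolP. Qed.

Definition mk_resfrac (a s : A) (ps : ~ p s) : resfrac :=
  @exist _ (fun x : A * A => `[< ~ p x.2 >]) (a, s) (asboolT ps).

Definition resfrac_eq x y :=
  `[< p ((val x).1 * (val y).2 - (val y).1 * (val x).2) >].

Lemma specMr (a b : A) : p a -> p (a * b).
Proof. by rewrite mulrC; exact: specMl. Qed.

Lemma specN (a : A) : p a -> p (- a).
Proof. by rewrite -mulN1r; exact: specMl. Qed.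

Lemma spec_mulN (a b : A) : ~ p a -> ~ p b -> ~ p (a * b).
Proof. by move=> na nb /specM []. Qed.

Lemma spec_cancel (a s : A) : ~ p s -> p (s * a) -> p a.
Proof. by move=> ns /specM []. Qed.

Lemma resfrac_eq_refl : reflexive resfrac_eq.
Proof. by move=> x; apply/asboolP; rewrite subrr; exact: spec0. Qed.

Lemma resfrac_eq_sym : symmetric resfrac_eq.
Proof.
suff H x y : resfrac_eq x y -> resfrac_eq y x.
  by move=> x y; apply/idP/idP; exact: H.
by move=> /asboolP /specN; rewrite opprB => ?; apply/asboolP.
Qed.

Lemma resfrac_eq_trans : transitive resfrac_eq.
Proof.
move=> y x z /asboolP xy /asboolP yz; apply/asboolP.
apply: (@spec_cancel _ (val y).2); first exact: resfracP.
have := specD (specMl (val z).2 xy) (specMl (val x).2 yz).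
by congr (p _); ring.
Qed.

Canonical resfrac_equiv :=
  EquivRel resfrac_eq resfrac_eq_refl resfrac_eq_sym resfrac_eq_trans.

Definition residue_field := {eq_quot resfrac_eq}.
HB.instance Definition _ : EqQuotient _ resfrac_eq residue_field :=
  EqQuotient.on residue_field.
HB.instance Definition _ := Choice.on residue_field.

Lemma resfracE x y :
  \pi_residue_field x = \pi_residue_field y <->
  p ((val x).1 * (val y).2 - (val y).1 * (val x).2).
Proof. by split=> [/eqmodP /asboolP|h]; last by apply/eqmodP/asboolP. Qed.

Lemma repr_resfrac x :
  p ((val (repr (\pi_residue_field x))).1 * (val x).2
     - (val x).1 * (val (repr (\pi_residue_field x))).2).
Proof. by apply/resfracE; rewrite reprK. Qed.

Definition resfrac0 : resfrac := mk_resfrac 0 (@specN1 _ p).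
Definition resfrac1 : resfrac := mk_resfrac 1 (@specN1 _ p).
Definition resfrac_opp x : resfrac := mk_resfrac (- (val x).1) (@resfracP x).
Definition resfrac_add x y : resfrac :=
  mk_resfrac ((val x).1 * (val y).2 + (val y).1 * (val x).2)
    (spec_mulN (@resfracP x) (@resfracP y)).
Definition resfrac_mul x y : resfrac :=
  mk_resfrac ((val x).1 * (val y).1) (spec_mulN (@resfracP x) (@resfracP y)).
Definition resfrac_inv x : resfrac :=
  if pselect (p (val x).1) is right np then mk_resfrac (val x).2 np
  else resfrac0.

Local Notation cls := (\pi_residue_field).
Implicit Types u v w : residue_field.

Definition res_opp u : residue_field := cls (resfrac_opp (repr u)).
Definition res_add u v : residue_field := cls (resfrac_add (repr u) (repr v)).
Definition res_mul u v : residue_field := cls (resfrac_mul (repr u) (repr v)).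
Definition res_inv u : residue_field := cls (resfrac_inv (repr u)).

Lemma res_oppE x : res_opp (cls x) = cls (resfrac_opp x).
Proof.
by apply/resfracE => /=; have := specN (repr_resfrac x); congr (p _); ring.
Qed.

Lemma res_addE x y : res_add (cls x) (cls y) = cls (resfrac_add x y).
Proof.
apply/resfracE => /=; have hx := repr_resfrac x; have hy := repr_resfrac y.
set x' := val (repr _) in hx *; set y' := val (repr _) in hy *.
have := specD (specMl (y'.2 * (val y).2) hx) (specMl (x'.2 * (val x).2) hy).
by congr (p _); ring.
Qed.

Lemma res_mulE x y : res_mul (cls x) (cls y) = cls (resfrac_mul x y).
Proof.
apply/resfracE => /=; have hx := repr_resfrac x; have hy := repr_resfrac y.
set x' := val (repr _) in hx *; set y' := val (repr _) in hy *.
have := specD (specMl (y'.1 * (val y).2) hx) (specMl (x'.2 * (val x).1) hy).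
by congr (p _); ring.
Qed.

Lemma res_addA : associative res_add.
Proof.
elim/quotW=> x; elim/quotW=> y; elim/quotW=> z.
rewrite (res_addE y z) (res_addE x) (res_addE x y) (res_addE _ z).
by apply/resfracE => /=; have := spec0 p; congr (p _); ring.
Qed.

Lemma res_addC : commutative res_add.
Proof.
elim/quotW=> x; elim/quotW=> y; rewrite !res_addE.
by apply/resfracE => /=; have := spec0 p; congr (p _); ring.
Qed.

Lemma res_add0 : left_id (cls resfrac0) res_add.
Proof.
elim/quotW=> x; rewrite !res_addE.
by apply/resfracE => /=; have := spec0 p; congr (p _); ring.
Qed.

Lemma res_addN : left_inverse (cls resfrac0) res_opp res_add.
Proof.
elim/quotW=> x; rewrite !res_oppE !res_addE.
by apply/resfracE => /=; have := spec0 p; congr (p _); ring.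
Qed.

HB.instance Definition _ :=
  GRing.isZmodule.Build residue_field res_addA res_addC res_add0 res_addN.

Lemma res_mulA : associative res_mul.
Proof.
elim/quotW=> x; elim/quotW=> y; elim/quotW=> z.
rewrite (res_mulE y z) (res_mulE x) (res_mulE x y) (res_mulE _ z).
by apply/resfracE => /=; have := spec0 p; congr (p _); ring.
Qed.

Lemma res_mulC : commutative res_mul.
Proof.
elim/quotW=> x; elim/quotW=> y; rewrite !res_mulE.
by apply/resfracE => /=; have := spec0 p; congr (p _); ring.
Qed.

Lemma res_mul1 : left_id (cls resfrac1) res_mul.
Proof.
elim/quotW=> x; rewrite !res_mulE.
by apply/resfracE => /=; have := spec0 p; congr (p _); ring.
Qed.

Lemma res_mulDl : left_distributive res_mul res_add.
Proof.
elim/quotW=> x; elim/quotW=> y; elim/quotW=> z.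
rewrite (res_addE x y) (res_mulE _ z) (res_mulE x z) (res_mulE y z) res_addE.
by apply/resfracE => /=; have := spec0 p; congr (p _); ring.
Qed.

Lemma res_neq0 : cls resfrac1 != 0.
Proof.
apply/eqP => /resfracE /=; rewrite mulr1 mul0r subr0; exact: specN1.
Qed.

HB.instance Definition _ := GRing.Zmodule_isComNzRing.Build residue_field
  res_mulA res_mulC res_mul1 res_mulDl res_neq0.

Lemma res_mulV u : u != 0 -> res_inv u * u = 1.
Proof.
move=> u0; rewrite -[in X in _ * X](reprK u) [LHS]res_mulE.
apply/resfracE; rewrite /resfrac_inv; case: pselect => [pu|npu] /=.
  case/eqP: u0; rewrite -(reprK u); apply/resfracE => /=.
  by rewrite mulr1 mul0r subr0.
by have := spec0 p; congr (p _); ring.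
Qed.

Lemma res_inv0 : res_inv 0 = 0.
Proof.
apply/resfracE; rewrite /resfrac_inv; case: pselect => [pu|npu] /=.
  by have := spec0 p; congr (p _); ring.
case: npu; have := repr_resfrac resfrac0 => /=.
by rewrite mulr1 mul0r subr0.
Qed.

HB.instance Definition _ :=
  GRing.ComNzRing_isField.Build residue_field res_mulV res_inv0.

Lemma res_subE x y :
  cls x - cls y = cls (resfrac_add x (resfrac_opp y)) :> residue_field.
Proof. by rewrite -res_addE -res_oppE. Qed.

Lemma res_prodE x y : cls x * cls y = cls (resfrac_mul x y) :> residue_field.
Proof. by rewrite -res_mulE. Qed.

End ResidueField.

Section RingMorphisms.
Variables (A B : comPzRingType) (phi : {rmorphism A -> B}).

Section Comap.
Variable q : spec B.
Let P : set A := phi @^-1` q.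
Let P0 : P 0. Proof. by rewrite /P /= rmorph0; exact: spec0. Qed.
Let PD a b : P a -> P b -> P (a + b).
Proof. by rewrite /P /= rmorphD; exact: specD. Qed.
Let PMl a b : P b -> P (a * b).
Proof. by rewrite /P /= rmorphM; exact: specMl. Qed.
Let PN1 : ~ P 1. Proof. by rewrite /P /= rmorph1; exact: specN1. Qed.
Let PM a b : P (a * b) -> P a \/ P b.
Proof. by rewrite /P /= rmorphM; exact: specM. Qed.

Definition comap : spec A := Spec P0 PD PMl PN1 PM.
End Comap.

Section ResidueMap.
Variable q : spec B.

Definition resfrac_map (x : resfrac (comap q)) : resfrac q :=
  @mk_resfrac B q (phi (val x).1) (phi (val x).2) (@resfracP _ _ x).

Definition residue_map (u : residue_field (comap q)) : residue_field q :=
  \pi_(residue_field q) (resfrac_map (repr u)).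

Lemma residue_mapE x :
  residue_map (\pi x) = \pi_(residue_field q) (resfrac_map x).
Proof.
apply/resfracE => /=; have := repr_resfrac x.
by rewrite /= !(rmorphB, rmorphM).
Qed.

Lemma residue_map_is_zmod_morphism : zmod_morphism residue_map.
Proof.
elim/quotW=> x; elim/quotW=> y.
rewrite res_subE !residue_mapE res_subE.
congr (\pi_(residue_field q) _); apply: val_inj => /=.
by rewrite !(rmorphD, rmorphM, rmorphN).
Qed.

Lemma residue_map_is_monoid_morphism : monoid_morphism residue_map.
Proof.
split; first by rewrite [LHS]residue_mapE; apply/resfracE => /=;
  rewrite !rmorph1 subrr; exact: spec0.
elim/quotW=> x; elim/quotW=> y.
rewrite res_prodE !residue_mapE res_prodE.
by congr (\pi_(residue_field q) _); apply: val_inj => /=; rewrite !rmorphM.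
Qed.

HB.instance Definition _ := GRing.isZmodMorphism.Build
  (residue_field (comap q)) (residue_field q) residue_map
  residue_map_is_zmod_morphism.
HB.instance Definition _ := GRing.isMonoidMorphism.Build
  (residue_field (comap q)) (residue_field q) residue_map
  residue_map_is_monoid_morphism.
End ResidueMap.

Definition module_finite := exists (n : nat) (e : 'I_n -> B),
  forall b, exists c : 'I_n -> A, b = \sum_i phi (c i) * e i.

Definition integral_hom := forall b : B, exists (n : nat) (c : 'I_n -> A),
  b ^+ n + \sum_(i < n) phi (c i) * b ^+ i = 0.

Definition subintegral_hom := [/\ injective phi, integral_hom,
  bijective comap & forall q : spec B, bijective (@residue_map q)].

End RingMorphisms.

Definition homeomorphism (S T : topologicalType) (f : S -> T) :=
  exists g : T -> S, [/\ cancel f g, cancel g f, continuous f & continuous g].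

(* R[i] with the topology of its modulus. *)
HB.instance Definition _ (R : realType) := NormedModule.copy R[i] (R[i])^o.

Lemma rmorphism_ext (A B : pzSemiRingType) (f g : {rmorphism A -> B}) :
  (forall a, f a = g a) -> f = g.
Proof.
case: f g => [f [[a] [b]]] [g [[c] [d]]] /= /funext fg; subst g.
by rewrite (Prop_irrelevance c a) (Prop_irrelevance b d).
Qed.

(* X = Spec (C[X]) together with a closed embedding in C^n, given by the      *)
(* generators coord_gen of C[X].                                              *)
Record affine_variety (R : realType) := AffineVariety {
  coord_ring :> comPzRingType;
  coord_cst : {rmorphism R[i] -> coord_ring};
  coord_reduced : forall (a : coord_ring) (n : nat), a ^+ n = 0 -> a = 0;
  embdim : nat;
  coord_gen : 'I_embdim -> coord_ring;
  coord_generated : forall S : set coord_ring,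
    (forall c, S (coord_cst c)) -> (forall i, S (coord_gen i)) ->
    (forall a b, S a -> S b -> S (a + b)) ->
    (forall a b, S a -> S b -> S (a * b)) -> S = setT }.

Section Points.
Variables (R : realType) (X : affine_variety R).

(* X(C): by the Nullstellensatz, a closed point of X is the kernel of a       *)
(* unique C-algebra morphism C[X] -> C, namely evaluation at that point.      *)
Record vpoint := VPoint {
  eval :> {rmorphism X -> R[i]};
  eval_cst : forall c, eval (coord_cst X c) = c }.

Lemma vpoint_ext (x y : vpoint) : (forall a, x a = y a) -> x = y.
Proof.
case: x y => [x xP] [y yP] /= xy.
have xyE : x = y by exact: rmorphism_ext.
by subst y; congr VPoint; exact: Prop_irrelevance.
Qed.

HB.instance Definition _ := gen_eqMixin vpoint.
HB.instance Definition _ := gen_choiceMixin vpoint.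

Section Kernel.
Variable x : vpoint.
Let P : set X := [set a | x a = 0].
Let P0 : P 0. Proof. by rewrite /P /= rmorph0. Qed.
Let PD a b : P a -> P b -> P (a + b).
Proof. by rewrite /P /= rmorphD => -> ->; rewrite addr0. Qed.
Let PMl a b : P b -> P (a * b).
Proof. by rewrite /P /= rmorphM => ->; rewrite mulr0. Qed.
Let PN1 : ~ P 1.
Proof. by rewrite /P /= rmorph1; exact/eqP/oner_neq0. Qed.
Let PM a b : P (a * b) -> P a \/ P b.
Proof.
by rewrite /P /= rmorphM => /eqP; rewrite mulf_eq0 => /orP[] /eqP; [left|right].
Qed.

Definition closed_point : spec X := Spec P0 PD PMl PN1 PM.
End Kernel.

Definition coords (x : vpoint) : 'rV[R[i]]_(embdim X) :=
  \row_i x (coord_gen i).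

Lemma coords_inj : injective coords.
Proof.
move=> x y xy; apply: vpoint_ext => a.
suff ST : [set b | x b = y b] = setT by have : setT a by []; rewrite -ST.
apply: coord_generated => /= [c|i|b c|b c]; first by rewrite !eval_cst.
- by have := congr1 (fun v : 'rV_(embdim X) => v ord0 i) xy; rewrite !mxE.
- by rewrite !rmorphD => -> ->.
- by rewrite !rmorphM => -> ->.
Qed.

(* The subspace topologies of X(C) in Spec (C[X]) and in C^n.                 *)
Definition zariski := initial_topology closed_point.
Definition euclidean := initial_topology coords.
HB.instance Definition _ := Topological.on zariski.
HB.instance Definition _ := Topological.on euclidean.

Definition regular_on (U : set zariski) (f : vpoint -> R[i]) :=
  forall x, U x -> exists (a b : X) (W : set zariski),
    [/\ open W, W x, W `<=` U &
        forall y : vpoint, W y -> y b != 0 /\ f y = y a / y b].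

Definition is_rational (f : vpoint -> R[i]) :=
  exists U : set zariski, [/\ open U, dense U & regular_on U f].

Definition K0_pred : {pred vpoint -> R[i]} :=
  [pred f | `[< is_rational f /\ continuous (f : euclidean -> R[i]) >]].

Lemma rational_cst c : is_rational (cst c).
Proof.
exists setT; split; [exact: openT | by move=> O O0 _; rewrite setIT |].
move=> x _; exists (coord_cst X c), 1, setT; split=> // [|y _].
  exact: openT.
by rewrite eval_cst rmorph1 oner_eq0 divr1.
Qed.

Lemma rational_op (f g : vpoint -> R[i]) (op : R[i] -> R[i] -> R[i]) :
  (forall a b c d : X, exists e : X, forall x : vpoint,
      x b != 0 -> x d != 0 -> op (x a / x b) (x c / x d) = x e / x (b * d)) ->
  is_rational f -> is_rational g -> is_rational (fun x => op (f x) (g x)).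
Proof.
move=> opP [U [oU dU fU]] [V [oV dV gV]]; exists (U `&` V).
split; first exact: openI.
  move=> O O0 oO; rewrite setIA; apply: dV; last exact: openI.
  exact: dU.
move=> x [Ux Vx]; have [a [b [W [oW Wx WU fW]]]] := fU x Ux.
have [c [d [W' [oW' W'x W'V gW']]]] := gV x Vx.
have [e eP] := opP a b c d.
exists e, (b * d), (W `&` W'); split=> //.
- exact: openI.
- by move=> y [/WU ? /W'V ?].
- move=> y [/fW [yb ->] /gW' [yd ->]]; split; last exact: eP.
  by rewrite rmorphM mulf_neq0.
Qed.

Lemma K0_subring_closed : subring_closed K0_pred.
Proof.
split.
- apply/asboolP; split; first exact: (rational_cst 1).
  exact: (@cst_continuous euclidean R[i] 1).
- move=> f g /asboolP [rf cf] /asboolP [rg cg]; apply/asboolP; split.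
    apply: (@rational_op f g (fun u v => u - v)) => // a b c d.
    exists (a * d - c * b) => x xb xd.
    rewrite rmorphB !rmorphM mulrBl; congr (_ - _).
      by rewrite -mulf_div divff // mulr1.
    by rewrite (mulrC (x b)) -mulf_div divff // mulr1.
  by move=> x; exact: (cvgB (cf x) (cg x)).
- move=> f g /asboolP [rf cf] /asboolP [rg cg]; apply/asboolP; split.
    apply: (@rational_op f g (fun u v => u * v)) => // a b c d.
    by exists (a * c) => x xb xd; rewrite mulf_div !rmorphM.
  by move=> x; exact: (cvgM (cf x) (cg x)).
Qed.

Record K0 := MkK0 { K0_fun :> vpoint -> R[i]; _ : K0_fun \in K0_pred }.
HB.instance Definition _ := [isSub for K0_fun].
HB.instance Definition _ := [Choice of K0 by <:].
HB.instance Definition _ := GRing.SubChoice_isSubComPzRing.Build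
  (vpoint -> R[i]) K0_pred K0 K0_subring_closed.

End Points.

Record variety_morphism (R : realType) (Y X : affine_variety R) :=
  VarietyMorphism {
  comorphism :> {rmorphism X -> Y};
  comorphism_cst : forall c, comorphism (coord_cst X c) = coord_cst Y c }.

Section Morphisms.
Variables (R : realType) (Y X : affine_variety R) (pi : variety_morphism Y X).

Definition finite_morphism := module_finite pi.
Definition subintegral := subintegral_hom pi.

Definition spec_map : spec Y -> spec X := comap pi.

Section PointMap.
Variable y : vpoint Y.
Let E : {rmorphism X -> R[i]} := y \o pi.
Let E_cst c : E (coord_cst X c) = c.
Proof. by rewrite /E /= comorphism_cst eval_cst. Qed.
Definition point_map : vpoint X := VPoint E_cst.
End PointMap.

Lemma closed_point_map (y : vpoint Y) :
  closed_point (point_map y) = spec_map (closed_point y).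
Proof. exact: spec_ext. Qed.

End Morphisms.

(* Main.v *)
Require Import Defs.
From HB Require Import structures.
From mathcomp Require Import all_boot all_order all_algebra generic_quotient.
From mathcomp Require Import ring complex.
From mathcomp Require Import all_classical all_reals all_analysis.

(** Everything is equivalent to bijectivity on closed points.  Going up holds
    because pi is integral, and C[Y] satisfies the Nullstellensatz because C is
    uncountable.  If b in C[Y] has minimal degree d over C[X] modulo a prime q,
    each root of the specialisation of its minimal relation at a general point x
    is the value of b at a point over x.  As pi is injective on points this
    specialisation is s (T - c)^d, and in characteristic 0 its coefficient of
    degree d - 1 shows that b is a fraction of elements of C[X] modulo q: the
    residue fields agree, and rational functions descend along pi.  The inverse
    of pi is Euclidean continuous at x0 since, the fibre over x0 being one point
    y0, a function b vanishing at y0 has a power in the ideal of C[Y] generated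
    by the maximal ideal of x0, whose coefficients tend to 0 while the module
    generators of C[Y] stay bounded. *)

Set Implicit Arguments.
Unset Strict Implicit.
Unset Printing Implicit Defensive.

Import Order.TTheory GRing.Theory Num.Theory.
Import numFieldNormedType.Exports.
Local Open Scope classical_set_scope.
Local Open Scope quotient_scope.
Local Open Scope ring_scope.

(** * Primes and integral extensions *)

Section ResidueClass.
Variables (A : comPzRingType) (p : spec A).

Definition residue (a : A) : residue_field p :=
  \pi_(residue_field p) (mk_resfrac a (@specN1 _ p)).

Lemma residue_is_zmod_morphism : zmod_morphism residue.
Proof.
move=> a b; rewrite /residue res_subE; apply/resfracE => /=.
by have := spec0 p; congr (p _); ring.
Qed.

Lemma residue_is_monoid_morphism : monoid_morphism residue.
Proof.
split=> [//|a b]; rewrite /residue res_prodE; apply/resfracE => /=.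
by have := spec0 p; congr (p _); ring.
Qed.

HB.instance Definition _ :=
  GRing.isZmodMorphism.Build A (residue_field p) residue
    residue_is_zmod_morphism.
HB.instance Definition _ :=
  GRing.isMonoidMorphism.Build A (residue_field p) residue
    residue_is_monoid_morphism.

Lemma residue_eq0 a : (residue a = 0) <-> p a.
Proof. by rewrite /residue resfracE /= mulr1 mul0r subr0. Qed.

Lemma specX a n : p (a ^+ n) -> p a.
Proof.
move/residue_eq0; rewrite rmorphXn /= => /eqP.
by rewrite expf_eq0 => /andP[_ /eqP/residue_eq0].
Qed.

End ResidueClass.

Definition is_ideal (A : comPzRingType) (I : set A) :=
  [/\ I 0, forall a b, I a -> I b -> I (a + b) & forall a b, I b -> I (a * b)].

Lemma spec_is_ideal (A : comPzRingType) (p : spec A) : is_ideal p.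
Proof. by split; [exact: spec0|exact: specD|exact: specMl]. Qed.

Lemma is_ideal0 (A : comPzRingType) : is_ideal [set 0 : A].
Proof. by split=> //= [a b -> ->|a b ->]; rewrite ?addr0 ?mulr0. Qed.

(** An ideal [J] maximal among those containing [I] and missing [M] is prime: if [a] and [b] lie
    outside it, [M] meets [J + (a)] and [J + (b)], hence also [J + (a * b)]. The last clause of the
    conclusion records this maximality. *)
Lemma prime_avoiding (A : comPzRingType) (I M : set A) :
    is_ideal I -> M 1 -> (forall a b, M a -> M b -> M (a * b)) ->
    (forall a, I a -> ~ M a) ->
  exists p : spec A, [/\ forall a, I a -> p a, forall a, M a -> ~ p a &
    forall a, ~ p a -> exists r, exists2 u, p u & M (u + r * a)].
Proof.
move=> [I0 ID IM] M1 MM IMN.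
pose P : set (set A) := [set J | J = set0 \/
  [/\ is_ideal J, I `<=` J & forall a, J a -> ~ M a]].
have [F FP Ftot|J [[->|[[J0 JD JM] IJ JMN]] Jmax]] := @Zorn_bigcup A P.
- have [[J [FJ J0]]|F0] := pselect (exists J, F J /\ J !=set0); last first.
    left; apply/seteqP; split=> // a [J FJ Ja]; apply: F0.
    by exists J; split=> //; exists a.
  have idl K b : F K -> K b -> [/\ is_ideal K, I `<=` K & forall a, K a -> ~ M a].
    by move=> FK Kb; have [K0|//] := FP _ FK; rewrite K0 in Kb.
  right; case: J0 => j Jj; have [[J0 JD JM] IJ JMN] := idl _ _ FJ Jj.
  split; [split| |].
  + by exists J.
  + move=> a b [K FK Ka] [L FL Lb]; have [KL|LK] := Ftot _ _ FK FL.
      exists L => //; have [[_ LD _] _ _] := idl _ _ FL Lb.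
      by apply: LD => //; exact: KL.
    exists K => //; have [[_ KD _] _ _] := idl _ _ FK Ka.
    by apply: KD => //; exact: LK.
  + move=> a b [K FK Kb]; exists K => //.
    by have [[_ _ KM] _ _] := idl _ _ FK Kb; exact: KM.
  + by move=> a Ia; exists J => //; exact: IJ.
  + by move=> a [K FK Ka]; have [_ _] := idl _ _ FK Ka; exact.
- exfalso; apply: (Jmax I); last by right; split.
  by split=> // /(_ _ I0).
have Jmeets a : ~ J a -> exists r, exists2 u, J u & M (u + r * a).
  move=> Ja; apply: contrapT => nM.
  pose K := [set b | exists r, exists2 u, J u & b = u + r * a].
  apply: (Jmax K); first split.
  - by move=> b Jb; exists 0, b; rewrite // mul0r addr0.
  - by move=> KJ; apply: Ja; apply: KJ; exists 1, 0; rewrite // mul1r add0r.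
  right; split; first split.
  - by exists 0, 0; rewrite // mul0r addr0.
  - move=> _ _ [r [u Ju ->]] [s [v Jv ->]]; exists (r + s), (u + v).
      exact: JD.
    by ring.
  - move=> b _ [r [u Ju ->]]; exists (b * r), (b * u); first exact: JM.
    by ring.
  - by move=> b /IJ Jb; exists 0, b; rewrite // mul0r addr0.
  - by move=> _ [r [u Ju ->]] Mu; apply: nM; exists r, u.
have JN1 : ~ J 1 by move=> /JMN; exact.
have Jprime a b : J (a * b) -> J a \/ J b.
  move=> Jab; apply: contrapT => /not_orP[/Jmeets[r [u Ju Mu]]].
  move=> /Jmeets[s [v Jv Mv]]; apply: (JMN _ _ (MM _ _ Mu Mv)).
  have -> : (u + r * a) * (v + s * b) =
    (v + s * b) * u + (r * a * v + (r * s) * (a * b)) by ring.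
  by apply: (JD); [exact: JM|apply: JD; exact: JM].
exists (Spec J0 JD JM JN1 Jprime); split=> //= a Ma Ja; exact: JMN Ja Ma.
Qed.

(** Take [q] containing [I] and maximal among the ideals missing the image of the complement of [p].
    If [a] in [p] had [phi a] outside [q], some [phi t] with [t] outside [p] would equal [r * phi a]
    modulo [q], and an integral equation of [r] forces [t] into [p]. *)
Lemma going_up (A B : comPzRingType) (phi : {rmorphism A -> B}) (I : set B)
    (p : spec A) :
    integral_hom phi -> is_ideal I -> (forall a, I (phi a) -> p a) ->
  exists q : spec B, (forall b, I b -> q b) /\ comap phi q = p.
Proof.
move=> phi_int Iid Ip; pose M := [set phi a | a in [set a | ~ p a]].
have M1 : M 1 by exists 1; [exact: specN1|exact: rmorph1].
have MM b c : M b -> M c -> M (b * c).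
  move=> [a pa <-] [a' pa' <-]; exists (a * a'); last exact: rmorphM.
  exact: spec_mulN.
have IM b : I b -> ~ M b by move=> Ib [a pa ab]; apply/pa/Ip; rewrite ab.
have [q [Iq Mq qmax]] := prime_avoiding Iid M1 MM IM.
exists q; split=> //; apply: spec_ext => a /=.
have qp c : q (phi c) -> p c.
  by move=> qc; apply: contrapT => pc; apply: Mq qc; exists c.
split; first exact: qp.
move=> pa; apply: contrapT => /qmax[r [u qu [t pt tE]]]; apply: pt.
have [n [c rE]] := phi_int r.
have {tE} tE : residue q (phi t) = residue q r * residue q (phi a).
  by rewrite tE rmorphD rmorphM /=; move/residue_eq0: qu => ->; rewrite add0r.
(* This is the equation of [r] multiplied by [phi a ^+ n]. Every term except [t ^+ n] has a factor
   [a], hence lies in [p]. *)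
have /qp : q (phi (t ^+ n + \sum_(i < n) c i * a ^+ (n - i) * t ^+ i)).
  apply/residue_eq0; rewrite rmorphD rmorphXn rmorph_sum rmorphD rmorphXn.
  rewrite rmorph_sum /= tE exprMn.
  transitivity (residue q
      (r ^+ n + \sum_(i < n) phi (c i) * r ^+ i) * residue q (phi a) ^+ n).
    rewrite rmorphD mulrDl rmorphXn rmorph_sum mulr_suml; congr (_ + _).
    apply: eq_bigr => i _; rewrite !(rmorphM, rmorphXn) /= tE exprMn.
    have -> : residue q (phi a) ^+ n =
        residue q (phi a) ^+ (n - i) * residue q (phi a) ^+ i.
      by rewrite -exprD subnK // ltnW.
    by ring.
  by rewrite rE rmorph0 mul0r.
move=> /residue_eq0; rewrite rmorphD rmorphXn rmorph_sum big1 ?addr0.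
  by move=> tn; apply: (@specX _ p _ n); apply/residue_eq0; rewrite rmorphXn.
move=> i _; rewrite !rmorphM !rmorphXn /=; move/residue_eq0: pa => ->.
by rewrite expr0n subn_eq0 leqNgt ltn_ord /= mulr0 mul0r.
Qed.

(** Determinant trick: if [C] describes multiplication by [b] on the generators, [\det (b - C)]
    kills each generator, hence 1, and [char_poly C] is a monic relation for [b]. *)
Lemma module_finite_integral_nz (A B : comNzRingType) (phi : {rmorphism A -> B}) :
  module_finite phi -> integral_hom phi.
Proof.
move=> [n [e span_e]] b.
have /boolp.choice[c cE] : forall i, exists d : 'I_n -> A,
    b * e i = \sum_j phi (d j) * e j by move=> i; exact: span_e.
pose C : 'M[A]_n := \matrix_(i, j) c i j.
pose D : 'M[B]_n := b%:M - map_mx phi C.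
have De : D *m (\col_i e i) = 0.
  apply/colP => i; rewrite mulmxBl mul_scalar_mx !mxE cE.
  by apply/eqP; rewrite subr_eq0; apply/eqP/eq_bigr => j _; rewrite !mxE.
have detDe i : \det D * e i = 0.
  have := congr1 (mulmx (\adj D)) De; rewrite mulmxA mul_adj_mx mulmx0.
  by rewrite mul_scalar_mx => /colP/(_ i); rewrite !mxE.
have detD : \det D = 0.
  have [d dE] := span_e 1; rewrite -[LHS]mulr1 dE mulr_sumr big1 // => i _.
  by rewrite mulrCA detDe mulr0.
have charE : (map_poly phi (char_poly C)).[b] = 0.
  rewrite map_char_poly -detD -[LHS]/(horner_eval b _) -det_map_mx.
  congr (\det _); apply/matrixP => i j; rewrite /char_poly_mx !mxE /= /horner_eval.
  by rewrite hornerD hornerN hornerMn hornerX hornerC.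
exists n, (fun i => (char_poly C)`_i); rewrite -[RHS]charE.
rewrite horner_coef size_map_poly_id0; last first.
  by have /monicP -> := char_poly_monic C; rewrite rmorph1 oner_neq0.
rewrite size_char_poly big_ord_recr /= addrC coef_map /=.
have /monicP := char_poly_monic C.
rewrite /lead_coef size_char_poly /= => ->; rewrite rmorph1 mul1r.
by congr (_ + _); apply: eq_bigr => i _; rewrite coef_map.
Qed.

(** Reduces statements about coordinate rings, which vanish for the empty variety, to nonzero rings,
    over which polynomials are formed. *)
Lemma trivial_or_nz (A : comPzRingType) :
  (1 = 0 :> A) \/ exists A' : comNzRingType, A = A' :> comPzRingType.
Proof.
case: (pselect (1 = 0 :> A)) => [|/eqP A1]; first by left.
right; case: A A1 => T c A1.
pose T' : comPzRingType := GRing.ComPzRing.Pack c.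
pose T'' : comNzRingType := HB.pack T
  c (GRing.PzSemiRing_isNonZero.Build T' A1).
by exists T''.
Qed.

Lemma module_finite_integral (A B : comPzRingType) (phi : {rmorphism A -> B}) :
  module_finite phi -> integral_hom phi.
Proof.
have triv : (1 = 0 :> B) -> integral_hom phi.
  by move=> B1 b; exists 0, (fun _ => 0); rewrite expr0 big_ord0 addr0.
have [A1|[A' A'E]] := trivial_or_nz A.
  by move=> _; apply: triv; rewrite -(rmorph1 phi) A1 rmorph0.
have [//|[B' B'E]] := trivial_or_nz B; first by move=> ? _; exact: triv.
by subst A B; exact: module_finite_integral_nz.
Qed.

(** * Nullstellensatz *)

Lemma closed_field_root_map (F : closedFieldType) (K : fieldType)
    (iota : {rmorphism F -> K}) (P : {poly F}) (t : K) :
  P != 0 -> (map_poly iota P).[t] = 0 -> exists z, t = iota z.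
Proof.
move=> P0; have [r ->] := closed_field_poly_normal P.
rewrite map_polyZ hornerZ rmorph_prod horner_prod => /eqP; rewrite mulf_eq0.
rewrite fmorph_eq0 lead_coef_eq0 (negPf P0) /= prodf_seq_eq0.
move=> /hasP[z _ /=]; rewrite map_polyXsubC hornerXsubC subr_eq0 => /eqP tz.
by exists z.
Qed.

(** With finite fibres [R] would be countable, whereas the unit interval has Lebesgue measure 1. *)
Lemma infinite_fiber (R : realType) (T : countType) (f : R -> T) :
  exists t, infinite_set (f @^-1` [set t]).
Proof.
apply: contrapT => /forallNP fin.
have cR : countable [set: R].
  have -> : [set: R] = \bigcup_(t in [set: T]) f @^-1` [set t].
    by apply/esym/seteqP; split=> // x _; exists (f x).
  apply: bigcup_countable => // t _; apply: finite_set_countable.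
  by apply: contrapT; exact: fin.
have c01 : countable (`[0%R, 1%R] : set R).
  by apply: sub_countable cR; exact: subset_card_le.
have := countable_lebesgue_measure0 c01.
rewrite lebesgue_measure_itv /= lte_fin ltr01 oppr0 adde0 => /eqP.
by rewrite eqe oner_eq0.
Qed.

Section Spanning.
Variables (R : realType) (X : affine_variety R).

(** Monomials are indexed by words: products become concatenations, and words form a countable
    type. *)
Definition word_monomial (w : seq 'I_(embdim X)) : X :=
  \prod_(i <- w) coord_gen i.

Lemma word_span_seq (b : X) :
  exists l : seq (R[i] * seq 'I_(embdim X)),
    b = \sum_(u <- l) coord_cst X u.1 * word_monomial u.2.
Proof.
pose S := [set b : X | exists l : seq (R[i] * seq 'I_(embdim X)),
  b = \sum_(u <- l) coord_cst X u.1 * word_monomial u.2].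
suff ST : S = setT by have : setT b by []; rewrite -ST.
apply: coord_generated => [c|i|_ _ [l ->] [m ->]|_ _ [l ->] [m ->]].
- by exists [:: (c, [::])]; rewrite big_seq1 /word_monomial big_nil mulr1.
- exists [:: (1, [:: i])].
  by rewrite big_seq1 /word_monomial big_seq1 rmorph1 mul1r.
- by exists (l ++ m); rewrite big_cat.
exists [seq (u.1 * v.1, u.2 ++ v.2) | u <- l, v <- m].
rewrite big_allpairs_dep mulr_suml; apply: eq_bigr => u _.
rewrite mulr_sumr; apply: eq_bigr => v _ /=.
by rewrite /word_monomial big_cat /= rmorphM; ring.
Qed.

(** The words are separated from the scalars because [W] alone ranges over a countable type, as
    [infinite_fiber] requires. *)
Lemma word_span (b : X) : exists (W : seq (seq 'I_(embdim X))) (c : nat -> R[i]),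
  b = \sum_(k < size W) coord_cst X (c k) * word_monomial (nth [::] W k).
Proof.
have [l ->] := word_span_seq b.
exists (map snd l), (fun k => (nth (0, [::]) l k).1).
rewrite size_map (big_nth (0, [::])) big_mkord.
by apply: eq_bigr => k _; rewrite (nth_map (0, [::])).
Qed.

(** The constant congruent to [t] modulo [q] is unique, since a field embeds in the residue field;
    sending [t] to it is therefore a ring morphism, with kernel [q]. *)
Lemma vpoint_of_prime (q : spec X) :
    (forall t, exists c, q (t - coord_cst X c)) ->
  exists x : vpoint X, closed_point x = q.
Proof.
move=> /boolp.choice[ev evP].
have ev_eq t c : q (t - coord_cst X c) -> ev t = c.
  move=> qtc; apply: (@fmorph_inj _ _ (residue q \o coord_cst X)) => /=.
  apply/eqP; rewrite -subr_eq0 -rmorphB; apply/eqP/residue_eq0.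
  have -> : coord_cst X (ev t) - coord_cst X c =
    (t - coord_cst X c) + -1 * (t - coord_cst X (ev t)) by ring.
  by apply: specD => //; exact: specMl.
have evB : zmod_morphism ev.
  move=> a b; apply: ev_eq; rewrite rmorphB.
  have -> : a - b - (coord_cst X (ev a) - coord_cst X (ev b)) =
    (a - coord_cst X (ev a)) + -1 * (b - coord_cst X (ev b)) by ring.
  by apply: specD => //; exact: specMl.
have evM : monoid_morphism ev.
  split; first by apply: ev_eq; rewrite rmorph1 subrr; exact: spec0.
  move=> a b; apply: ev_eq; rewrite rmorphM.
  have -> : a * b - coord_cst X (ev a) * coord_cst X (ev b) =
    b * (a - coord_cst X (ev a)) +
    coord_cst X (ev a) * (b - coord_cst X (ev b)) by ring.
  by apply: specD; exact: specMl.
pose f := HB.pack_for {rmorphism X -> R[i]} ev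
  (GRing.isZmodMorphism.Build _ _ ev evB)
  (GRing.isMonoidMorphism.Build _ _ ev evM).
have fc c : f (coord_cst X c) = c.
  by apply: ev_eq; rewrite subrr; exact: spec0.
exists (VPoint fc); apply: spec_ext => a /=; rewrite /f /=; split=> [a0|qa].
  by have := evP a; rewrite a0 rmorph0 subr0.
by apply: ev_eq; rewrite rmorph0 subr0.
Qed.

(* If [t - c] were invertible modulo [q] up to a power of [b] for all of the
   uncountably many constants [c], infinitely many of the inverses would lie in
   one finite-dimensional space; clearing denominators in a linear relation
   between them gives a polynomial relation for [t] modulo [q]. *)
Lemma maximal_avoiding_residue (q : spec X) (b : X) :
    ~ q b ->
    (forall a, ~ q a -> exists r, exists2 u, q u & exists n, b ^+ n = u + r * a) ->
  forall t, exists c, q (t - coord_cst X c).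
Proof.
move=> qb qmax t; apply: contrapT => /forallNP qt.
pose iota : {rmorphism R[i] -> residue_field q} := residue q \o coord_cst X.
have iotaE c : iota c = residue q (coord_cst X c) by [].
have tc c : residue q t - iota c != 0.
  by apply/eqP; rewrite iotaE -rmorphB => /residue_eq0; exact: qt.
(* Modulo [q], the fraction [b ^+ n / (t - r)] is the combination of the words of [W] with
   coefficients [c]. Real constants [r] are already uncountably many. *)
pose rel (r : R) (nW : nat * seq (seq 'I_(embdim X))) (c : nat -> R[i]) :=
  residue q b ^+ nW.1 = (residue q t - iota r%:C%C) *
  \sum_(k < size nW.2) iota (c k) * residue q (word_monomial (nth [::] nW.2 k)).
have /boolp.choice[nW nWP] : forall r, exists nW, exists c, rel r nW c.
  move=> r; have [h [u qu [n bn]]] := qmax _ (qt r%:C%C).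
  have [W [c hE]] := word_span h; exists (n, W), c.
  rewrite /rel /= -rmorphXn bn rmorphD /=; move/residue_eq0: qu => ->.
  rewrite add0r rmorphM mulrC rmorphB; congr (_ * _).
  by rewrite hE rmorph_sum; apply: eq_bigr => k _; rewrite rmorphM.
have [[n W] fibW] := infinite_fiber nW.
(* One constant more than there are words, so that the coefficient vectors are linearly
   dependent. *)
have [B Bsub Bsize] := infinite_set_fset (size W).+1 fibW.
set D := size W in Bsize; pose s := finmap.enum_fset B.
pose c (i : 'I_D.+1) : R[i] := (s`_i)%:C%C.
have iB (i : 'I_D.+1) : (i < size s)%N.
  exact: leq_trans (ltn_ord i) Bsize.
have c_inj : injective c.
  move=> i j [] /eqP; rewrite (nth_uniq 0 (iB i) (iB j)) ?finmap.fset_uniq //.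
  by move=> /eqP; exact: val_inj.
have /boolp.choice[lam lamP] : forall i : 'I_D.+1, exists l, rel (s`_i) (n, W) l.
  move=> i; have := nWP s`_i.
  by rewrite (Bsub s`_i) //; have : s`_i \in s by exact: mem_nth (iB i).
pose L : 'M[R[i]]_(D.+1, D) := \matrix_(i, k) lam i k.
have /rowV0Pn[v /sub_kermxP vL v0] : kermx L != 0.
  by rewrite -mxrank_eq0 mxrank_ker -lt0n subn_gt0 ltnS rank_leq_col.
(* Numerator of the sum of the [v 0 i / ('X - c i)], which vanishes at [t] by the choice of [v]. At
   [c i] only the term of index [i] survives, so [P] is nonzero. *)
pose P := \sum_i v 0 i *: \prod_(j | j != i) ('X - (c j)%:P).
have P0 : P != 0.
  have /rV0Pn[i vi] := v0; apply/eqP => /(congr1 (horner^~ (c i))).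
  rewrite horner0 horner_sum (bigD1 i) //= [X in _ + X]big1 ?addr0 => [|k ki].
    rewrite hornerZ horner_prod => /eqP; rewrite mulf_eq0 (negPf vi) /=.
    move=> /prodf_eq0[j ji]; rewrite hornerXsubC subr_eq0 => /eqP/c_inj ij.
    by rewrite ij eqxx in ji.
  rewrite hornerZ horner_prod (bigD1 i) 1?eq_sym //=.
  by rewrite hornerXsubC subrr mul0r mulr0.
have PE : (map_poly iota P).[residue q t] * residue q b ^+ n = 0.
  pose h i := \sum_(k < D) iota (lam i k) *
    residue q (word_monomial (nth [::] W k)).
  transitivity (\prod_j (residue q t - iota (c j)) * \sum_i iota (v 0 i) * h i).
    rewrite rmorph_sum horner_sum mulr_suml mulr_sumr; apply: eq_bigr => i _.
    rewrite /= map_polyZ hornerZ rmorph_prod horner_prod (lamP i) /=.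
    rewrite [in RHS](bigD1 i) //= -/(h i) -/(c i).
    rewrite (eq_bigr (fun j => residue q t - iota (c j))) => [|j _].
      by ring.
    by rewrite /= map_polyXsubC hornerXsubC.
  suff -> : \sum_i iota (v 0 i) * h i = 0 by rewrite mulr0.
  under eq_bigr => i _ do rewrite mulr_sumr.
  rewrite exchange_big big1 //= => k _.
  under eq_bigr => i _ do rewrite mulrA -(rmorphM iota).
  rewrite -mulr_suml -(rmorph_sum iota).
  have := congr1 (fun A : 'rV_D => A 0 k) vL; rewrite !mxE.
  under eq_bigr => i _ do rewrite mxE.
  by move=> ->; rewrite rmorph0 mul0r.
have [|z tz] := @closed_field_root_map _ _ iota P (residue q t) P0.
  move/eqP: PE; rewrite mulf_eq0 => /orP[/eqP//|].
  by rewrite expf_eq0 => /andP[_ /eqP/residue_eq0].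
by have := tc z; rewrite tz subrr eqxx.
Qed.

(** An ideal containing [I] and maximal among those missing the powers of [b] is the kernel of a
    point, by [maximal_avoiding_residue]. *)
Lemma nullstellensatz (I : set X) (b : X) :
    is_ideal I -> (forall n, ~ I (b ^+ n)) ->
  exists x : vpoint X, (forall a, I a -> x a = 0) /\ x b <> 0.
Proof.
move=> Iid Ib; pose M := [set a | exists n, a = b ^+ n].
have MM a a' : M a -> M a' -> M (a * a').
  by move=> [m ->] [n ->]; exists (m + n)%N; rewrite exprD.
have M1 : M 1 by exists 0%N.
have IM a : I a -> ~ M a by move=> Ia [n an]; apply: (Ib n); rewrite -an.
have [q [Iq Mq qmax]] := prime_avoiding Iid M1 MM IM.
have qb : ~ q b by apply: Mq; exists 1%N.
have [|x xq] := @vpoint_of_prime q.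
  apply: (maximal_avoiding_residue qb) => a /qmax[r [u qu [n un]]].
  by exists r, u => //; exists n.
by exists x; split=> [a /Iq|xb]; [rewrite -xq|apply: qb; rewrite -xq].
Qed.

Lemma nullstellensatz_prime (q : spec X) (b : X) :
  ~ q b -> exists x : vpoint X, (forall a, q a -> x a = 0) /\ x b <> 0.
Proof.
move=> qb; apply: nullstellensatz; first exact: spec_is_ideal.
by move=> n /specX.
Qed.

Lemma vpoint_nonzero (b : X) : b <> 0 -> exists x : vpoint X, x b <> 0.
Proof.
move=> b0; have [|x [_ xb]] := @nullstellensatz _ b (is_ideal0 X).
  by move=> n /coord_reduced.
by exists x.
Qed.

End Spanning.

(** * Fractions modulo a prime *)

Section ZeroPrime.
Variable F : fieldType.
Let Z : set F := [set 0].
Let Z0 : Z 0. Proof. by []. Qed.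
Let ZD a b : Z a -> Z b -> Z (a + b).
Proof. by rewrite /Z /= => -> ->; rewrite addr0. Qed.
Let ZMl a b : Z b -> Z (a * b). Proof. by rewrite /Z /= => ->; rewrite mulr0. Qed.
Let ZN1 : ~ Z 1. Proof. exact/eqP/oner_neq0. Qed.
Let ZM a b : Z (a * b) -> Z a \/ Z b.
Proof. by move=> /eqP; rewrite mulf_eq0 => /orP[] /eqP; [left|right]. Qed.
(** Its preimage under a morphism to [F] is the kernel of that morphism, as a prime. *)
Definition spec_zero : spec F := Spec Z0 ZD ZMl ZN1 ZM.
End ZeroPrime.

Section ExtendPoint.
Variables (R : realType) (Y : affine_variety R) (A : comPzRingType).
Variables (phi : {rmorphism A -> Y}) (cstA : {rmorphism R[i] -> A}).
Hypothesis phi_cst : forall c, phi (cstA c) = coord_cst Y c.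
Hypothesis phi_int : integral_hom phi.

(** Going up from the kernel of [x] gives a prime [q] modulo which each [phi a] is the constant
    [x a]. Integral equations then have constant coefficients, so all residues are constants and [q]
    comes from a point. [A] is any ring here, in order to apply to polynomial rings. *)
Lemma extend_point (I : set Y) (x : {rmorphism A -> R[i]}) :
    (forall c, x (cstA c) = c) -> is_ideal I -> (forall a, I (phi a) -> x a = 0) ->
  exists y : vpoint Y, (forall a, y (phi a) = x a) /\ forall b, I b -> y b = 0.
Proof.
move=> x_cst Iid Ix.
have [q [Iq qx]] := @going_up _ _ phi I (comap x (spec_zero _)) phi_int Iid Ix.
have qphi a : q (phi a - coord_cst Y (x a)).
  rewrite -phi_cst -rmorphB; suff: comap phi q (a - cstA (x a)) by [].
  by rewrite qx /= rmorphB x_cst subrr.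
pose iota : {rmorphism R[i] -> residue_field q} := residue q \o coord_cst Y.
have iotaE a : residue q (phi a) = iota (x a).
  by apply/eqP; rewrite -subr_eq0 -rmorphB; apply/eqP/residue_eq0.
have [|y yq] := @vpoint_of_prime _ _ q; last first.
  exists y; split=> [a|b /Iq]; last by rewrite -yq.
  have : closed_point y (phi a - coord_cst Y (x a)) by rewrite yq.
  by rewrite /= rmorphB eval_cst => /eqP; rewrite subr_eq0 => /eqP.
move=> t; have [n [c tE]] := phi_int t.
pose P : {poly R[i]} := 'X^n + \sum_(i < n) x (c i) *: 'X^i.
have P0 : P != 0.
  apply/eqP => /(congr1 (fun p : {poly R[i]} => p`_n)).
  rewrite coefD coefXn eqxx coef_sum coef0 big1 => [|i _]; last first.
    by rewrite coefZ coefXn gtn_eqF ?mulr0.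
  by rewrite addr0; exact/eqP/oner_neq0.
have [|z tz] := @closed_field_root_map _ _ iota P (residue q t) P0.
  rewrite rmorphD rmorph_sum hornerD horner_sum /= map_polyXn hornerXn.
  have := congr1 (residue q) tE; rewrite rmorphD rmorphXn rmorph_sum rmorph0.
  move=> E; rewrite -[RHS]E; congr (_ + _); apply: eq_bigr => i _ /=.
  by rewrite map_polyZ map_polyXn hornerZ hornerXn rmorphM rmorphXn /= iotaE.
exists z; apply/residue_eq0; rewrite rmorphB /= tz; exact: subrr.
Qed.

End ExtendPoint.

Lemma exists_poly_eval (A : comNzRingType) (B : comPzRingType)
    (phi : {rmorphism A -> B}) (b : B) : 1 <> 0 :> B ->
  exists ev : {rmorphism {poly A} -> B}, (forall a, ev a%:P = phi a) /\ ev 'X = b.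
Proof.
have [//|[B' B'E] _] := trivial_or_nz B; subst B.
exists (horner_eval b \o map_poly phi); split=> [a|] /=.
  by rewrite map_polyC /horner_eval hornerC.
by rewrite map_polyX /horner_eval hornerX.
Qed.

(* A polynomial all of whose roots coincide is s (X - c)^d, and then the
   coefficient of degree d - 1 is - d s c. *)
Lemma single_root_poly (F : closedFieldType) (f : {poly F}) :
    (forall c c', root f c -> root f c' -> c = c') -> (1 < size f)%N ->
  let d := (size f).-1 in let s := lead_coef f in
  ((s *+ d) *: 'X + (f`_d.-1)%:P) ^+ d = (s ^+ d.-1 *+ d ^ d) *: f.
Proof.
move=> f1 size_f d s; have [r fE] := closed_field_poly_normal f.
have s0 : s != 0 by rewrite lead_coef_eq0 -size_poly_gt0 ltnW.
have size_r : size r = d.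
  by rewrite /d fE size_scale ?lead_coef_eq0 ?(size_prod_XsubC r id) -?lead_coef_eq0.
have root_r z : z \in r -> root f z.
  by rewrite fE rootZ ?root_prod_XsubC.
have d0 : (0 < d)%N by rewrite /d -subn1 subn_gt0.
pose c := r`_0; have rE : r = nseq d c.
  rewrite -size_r; apply/all_pred1P/allP => z zr /=; apply/eqP.
  by apply: f1; apply: root_r => //; rewrite mem_nth ?size_r.
have prE : \prod_(z <- r) ('X - z%:P) = ('X - c%:P) ^+ d.
  by rewrite rE big_nseq iter_mulr_1.
have coefE : f`_d.-1 = - (s * c *+ d).
  rewrite fE coefZ -size_r (coefPn_prod_XsubC (ps := r)); last first.
    by rewrite size_r -lt0n.
  by rewrite rE big_nseq iter_addr_0 -/s mulrN mulrnAr size_nseq.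
rewrite coefE fE prE -/s.
have -> : (s *+ d) *: 'X + (- (s * c *+ d))%:P = (s *+ d) *: ('X - c%:P).
  by rewrite scalerBr polyCN -mul_polyC -mul_polyC -polyCM mulrnAl.
rewrite exprZn scalerA exprMn_n; congr (_ *: _).
by rewrite mulrnAl -exprSr prednK.
Qed.

Lemma size_poly_leS (A : nzSemiRingType) (p : {poly A}) (m : nat) :
  (size p <= m.+1)%N -> p`_m = 0 -> (size p <= m)%N.
Proof.
move=> /leq_sizeP pm pm0; apply/leq_sizeP => j.
by rewrite leq_eqVlt => /orP[/eqP <- //|]; exact: pm.
Qed.

Section GenericFraction.
Variables (R : realType) (Y : affine_variety R).

Section NonZeroRing.
Variables (A : comNzRingType) (phi : {rmorphism A -> Y}).
Variables (cstA : {rmorphism R[i] -> A}) (q : spec Y).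
Hypothesis phi_cst : forall c, phi (cstA c) = coord_cst Y c.
Hypothesis phi_int : integral_hom phi.
Hypothesis phi_inj :
  forall y y' : vpoint Y, (forall a, y (phi a) = y' (phi a)) -> y = y'.

Section Element.
Variables (b : Y) (ev : {rmorphism {poly A} -> Y}).
Hypothesis evC : forall a, ev a%:P = phi a.
Hypothesis evX : ev 'X = b.

Let evZ a (g : {poly A}) : ev (a *: g) = phi a * ev g.
Proof. by rewrite -mul_polyC rmorphM evC. Qed.

(** A polynomial relation for [b] modulo [q], with coefficients kept in [A]. The leading coefficient
    survives modulo [q], so that minimal size means minimal degree over the fractions of [A] modulo
    [q]. *)
Definition relation_mod (f : {poly A}) := ~ q (phi (lead_coef f)) /\ q (ev f).

Lemma minimal_relation_mod : exists2 f, relation_mod f &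
  forall g, relation_mod g -> (size f <= size g)%N.
Proof.
have ex : exists n, `[< exists f, relation_mod f /\ size f = n >].
  have [n [c bE]] := phi_int b; pose g := \sum_(i < n) c i *: 'X^i : {poly A}.
  have size_g : (size g < size ('X^n : {poly A}))%N.
    rewrite size_polyXn ltnS (leq_trans (size_sum _ _ _)) //.
    apply/bigmax_leqP => i _; rewrite (leq_trans (size_scale_leq _ _)) //.
    by rewrite size_polyXn.
  exists (size ('X^n + g)); apply/asboolP; exists ('X^n + g); split=> //; split.
    by rewrite lead_coefDl // lead_coefXn rmorph1; exact: specN1.
  rewrite rmorphD rmorphXn rmorph_sum /= evX.
  rewrite (eq_bigr (fun i => phi (c i) * b ^+ i)) ?bE; first exact: spec0.
  by move=> i _; rewrite evZ rmorphXn /= evX.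
case: (ex_minnP ex) => _ /asboolP[f [relf <-]] fmin.
by exists f => // g relg; apply: fmin; apply/asboolP; exists g.
Qed.

Variable f : {poly A}.
Hypothesis f_rel : relation_mod f.
Hypothesis f_min : forall g, relation_mod g -> (size f <= size g)%N.

(** Pseudo-division of [g] by [f], by induction on the size of [g]. *)
Lemma minimal_relation_root (x : {rmorphism A -> R[i]}) (c : R[i]) :
    (forall a, q (phi a) -> x a = 0) -> x (lead_coef f) <> 0 ->
    root (map_poly x f) c ->
  forall g, q (ev g) -> (map_poly x g).[c] = 0.
Proof.
move=> xq xf fc g; have [n] := ubnP (size g); elim: n g => // n IHn g.
rewrite ltnS => size_g qg.
have [->|g0] := eqVneq g 0; first by rewrite map_poly0 horner0.
have size_gE := polySpred g0; set m := (size g).-1 in size_gE.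
have [ql|ql] := pselect (q (phi (lead_coef g))).
  have size_g' : (size (g - lead_coef g *: 'X^m)%R < n)%N.
    apply: leq_trans size_g; rewrite size_gE ltnS; apply: size_poly_leS.
      rewrite (leq_trans (size_polyD _ _)) // geq_max size_gE leqnn /= size_polyN.
      by rewrite (leq_trans (size_scale_leq _ _)) // size_polyXn.
    by rewrite coefB coefZ coefXn eqxx mulr1 subrr.
  have qg' : q (ev (g - lead_coef g *: 'X^m)).
    rewrite rmorphB evZ; apply: specD => //.
    by rewrite -mulN1r; apply: specMl; rewrite mulrC; exact: specMl.
  have := IHn _ size_g' qg'.
  by rewrite rmorphB hornerD hornerN /= map_polyZ hornerZ (xq _ ql) mul0r subr0.
(* Otherwise [g] is itself a relation, and by minimality a multiple of [f] can cancel its leading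
   term. *)
have size_fg : (size f <= size g)%N by exact: f_min.
pose k := (size g - size f)%N.
have f0 : f != 0.
  by apply/eqP => f0; apply: xf; rewrite f0 lead_coef0 rmorph0.
have mE : m = (k + (size f).-1)%N.
  apply: succn_inj; rewrite -size_gE -addnS -polySpred //.
  by rewrite subnK.
pose g' := lead_coef f *: g - lead_coef g *: ('X^k * f).
have size_g' : (size g' < n)%N.
  apply: leq_trans size_g; rewrite size_gE ltnS; apply: size_poly_leS.
    rewrite (leq_trans (size_polyD _ _)) // geq_max size_polyN.
    rewrite !(leq_trans (size_scale_leq _ _)) ?size_gE //.
    rewrite (leq_trans (size_polyMleq _ _)) // size_polyXn /= mE.
    by rewrite -addnS -polySpred.
  rewrite coefB !coefZ coefXnM mE ltnNge leq_addr /= addKn.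
  by rewrite -mE -!/(lead_coef _) mulrC subrr.
have qg' : q (ev g').
  rewrite rmorphB !evZ rmorphM; apply: specD; first exact: specMl.
  rewrite -mulN1r; do 3 apply: specMl; exact: f_rel.2.
have := IHn _ size_g' qg'; rewrite rmorphB hornerD hornerN /= !map_polyZ !hornerZ.
rewrite rmorphM hornerM (rootP fc) !mulr0 subr0 => /eqP.
by rewrite mulf_eq0 => /orP[/eqP|/eqP].
Qed.

(** The pair of [x] and [c] is a point of [{poly A}], and [minimal_relation_root] says that it kills
    the preimage of [q] under [ev]; [extend_point] lifts it along [ev]. *)
Lemma minimal_relation_point (x : {rmorphism A -> R[i]}) (c : R[i]) :
    (forall c, x (cstA c) = c) ->
    (forall a, q (phi a) -> x a = 0) -> x (lead_coef f) <> 0 ->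
    root (map_poly x f) c ->
  exists y : vpoint Y, (forall a, y (phi a) = x a) /\ y b = c.
Proof.
move=> x_cst xq xf fc.
have ev_int : integral_hom ev.
  move=> t; have [n [d tE]] := phi_int t; exists n, (fun i => (d i)%:P).
  by rewrite -[RHS]tE; congr (_ + _); apply: eq_bigr => i _; rewrite evC.
have ev_cst c' : ev (cstA c')%:P = coord_cst Y c' by rewrite evC.
have [||g qg|y [yE _]] := @extend_point _ _ _ ev (polyC \o cstA) ev_cst ev_int q
    (horner_eval c \o map_poly x).
- by move=> d /=; rewrite /horner_eval map_polyC hornerC /=.
- exact: spec_is_ideal.
- exact: (minimal_relation_root xq xf fc).
exists y; split=> [a|].
  by rewrite -evC yE /= /horner_eval map_polyC hornerC.
by rewrite -evX yE /= /horner_eval map_polyX hornerX.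
Qed.

End Element.

Lemma fraction_mod_prime_nz b :
  exists s a, ~ q (phi s) /\ q (phi s * b - phi a).
Proof.
have [|ev [evC evX]] := @exists_poly_eval _ _ phi b.
  by move=> Y1; apply: (@specN1 _ q); rewrite Y1; exact: spec0.
have [f f_rel f_min] := minimal_relation_mod evC evX.
have [qs qf] := f_rel; set s := lead_coef f in qs.
pose d := (size f).-1; pose a := f`_d.-1.
have size_f : (1 < size f)%N.
  rewrite ltnNge; apply/negP => /size1_polyC fE.
  by apply: qs; rewrite /s fE lead_coefC -evC -fE.
(* The identity of [single_root_poly], written for [f] before specialisation. *)
pose G := ((s *+ d) *: 'X + a%:P) ^+ d - (s ^+ d.-1 *+ d ^ d) *: f.
(* Each root of [f] specialised at [y] is the value of [b] at a point with the same image as [y]. By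
   [phi_inj] there is only one such point, hence only one root. *)
have G0 (y : vpoint Y) : (forall t, q t -> y t = 0) -> y (phi s) <> 0 ->
    map_poly (y \o phi) G = 0.
  move=> yq ys; pose x : {rmorphism A -> R[i]} := y \o phi.
  have x_cst c : x (cstA c) = c by rewrite /x /= phi_cst eval_cst.
  have xq t : q (phi t) -> x t = 0 by exact: yq.
  have lead_x : lead_coef (map_poly x f) = x s.
    by rewrite lead_coef_map_eq //; exact/eqP.
  have size_x : size (map_poly x f) = size f.
    by rewrite size_map_poly_id0 //; exact/eqP.
  have := @single_root_poly _ (map_poly x f); rewrite size_x => /(_ _ size_f).
  rewrite /= lead_x coef_map -/d -/a => xG.
  rewrite -[map_poly _ G]/(map_poly x G) rmorphB rmorphXn rmorphD /=.
  rewrite !map_polyZ map_polyX map_polyC rmorphMn [x (_ *+ (d ^ d))]rmorphMn.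
  rewrite rmorphXn /= xG ?subrr // => c c' fc fc'.
  have [y1 [y1x <-]] := minimal_relation_point evC evX f_rel f_min x_cst xq ys fc.
  have [y2 [y2x <-]] := minimal_relation_point evC evX f_rel f_min x_cst xq ys fc'.
  by rewrite (phi_inj (y := y1) (y' := y2)) // => t; rewrite y1x y2x.
(* The product of [s] with a coefficient of [G] vanishes on the whole zero locus of [q]. *)
have qG i : q (phi G`_i).
  apply: contrapT => qGi.
  have [y [yq]] := nullstellensatz_prime (spec_mulN qs qGi).
  rewrite rmorphM => ysG.
  have ys : y (phi s) <> 0 by move=> ys; apply: ysG; rewrite ys mul0r.
  apply: ysG; have := congr1 (fun p : {poly R[i]} => p`_i) (G0 _ yq ys).
  by rewrite coef_map coef0 /= => ->; rewrite mulr0.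
have : q (ev G).
  rewrite -[G]coefK poly_def rmorph_sum.
  elim/big_ind: _ => [|u v|i _]; [exact: spec0|exact: specD|].
  by rewrite -mul_polyC rmorphM evC mulrC; exact: specMl.
rewrite rmorphB => qG'.
(* As [q] is prime it then contains [d s b + a]: modulo [q], [b] is the fraction [- a / (d s)]. *)
have : q (ev (((s *+ d) *: 'X + a%:P) ^+ d)).
  rewrite -[ev _](subrK (ev ((s ^+ d.-1 *+ d ^ d) *: f))); apply: specD => //.
  by rewrite -mul_polyC rmorphM; exact: specMl.
rewrite rmorphXn => /specX; rewrite rmorphD evC -mul_polyC rmorphM /= evC evX.
move=> qb; exists (s *+ d), (- a); rewrite rmorphN opprK; split=> //.
(* Characteristic 0: [d s] is nonzero at a point of the zero locus of [q] where [s] is. *)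
have [y [yq ys]] := nullstellensatz_prime qs.
move=> /yq; rewrite !rmorphMn => /eqP; rewrite mulrn_eq0 => /orP[|/eqP//].
by rewrite /d -subn1 subn_eq0 leqNgt size_f.
Qed.

End NonZeroRing.

Lemma fraction_mod_prime (A : comPzRingType) (phi : {rmorphism A -> Y})
    (cstA : {rmorphism R[i] -> A}) (q : spec Y) (b : Y) :
    (forall c, phi (cstA c) = coord_cst Y c) -> integral_hom phi ->
    (forall y y' : vpoint Y, (forall a, y (phi a) = y' (phi a)) -> y = y') ->
  exists s a, ~ q (phi s) /\ q (phi s * b - phi a).
Proof.
have [A1|[A' A'E]] := trivial_or_nz A.
  exfalso; apply: (@specN1 _ q).
  by rewrite -(rmorph1 phi) A1 rmorph0; exact: spec0.
by subst A => phi_cst phi_int phi_inj; exact: (fraction_mod_prime_nz q phi_cst).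
Qed.

End GenericFraction.

(** * Spectra and Zariski topology *)

Lemma inj_surj_bij (S T : Type) (f : S -> T) :
  injective f -> (forall t, exists s, f s = t) -> bijective f.
Proof.
by move=> f_inj /boolp.choice[g gK]; exists g => // s; apply: f_inj; rewrite gK.
Qed.

Lemma bij_surj (S T : Type) (f : S -> T) :
  bijective f -> forall t, exists s, f s = t.
Proof. by case=> g _ gK t; exists (g t). Qed.

Lemma homeomorphism_bij (S T : topologicalType) (f : S -> T) :
  homeomorphism f -> bijective f.
Proof. by move=> [g [fK gK _ _]]; exists g. Qed.

Section VPoint.
Variables (R : realType) (X : affine_variety R).

Lemma closed_point_inj : injective (@closed_point R X).
Proof.
move=> x y xy; apply: vpoint_ext => a.
have : closed_point y (a - coord_cst X (x a)).
  by rewrite -xy /= rmorphB eval_cst subrr.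
by rewrite /= rmorphB eval_cst => /eqP; rewrite subr_eq0 => /eqP.
Qed.

Lemma zariski_openP (U : set (zariski X)) :
  open U <-> exists S : set X, U = [set x | exists2 a, S a & x a <> 0].
Proof.
split=> [[_ [S ->] <-]|[S ->]].
  exists S; apply/seteqP; split=> x /=.
    by move=> /existsNP[a /not_implyP[Sa xa]]; exists a.
  by move=> [a Sa xa] /(_ a Sa).
exists (~` [set p : spec X | forall a, S a -> p a]); first by exists S.
apply/seteqP; split=> x /=.
  by move=> /existsNP[a /not_implyP[Sa xa]]; exists a.
by move=> [a Sa xa] /(_ a Sa).
Qed.

End VPoint.

Section FiniteMorphism.
Variables (R : realType) (Y X : affine_variety R) (pi : variety_morphism Y X).
Hypothesis pi_int : integral_hom pi.

Lemma lying_over (I : set Y) (x : vpoint X) :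
    is_ideal I -> (forall a, I (pi a) -> x a = 0) ->
  exists y, point_map pi y = x /\ forall b, I b -> y b = 0.
Proof.
move=> Iid Ix.
have [y [yx yI]] := extend_point (comorphism_cst pi) pi_int (eval_cst x) Iid Ix.
by exists y; split=> //; exact: vpoint_ext.
Qed.

Lemma point_map_bij_of_spec_map :
  bijective (spec_map pi) -> bijective (point_map pi).
Proof.
move=> /[dup] /bij_inj spec_inj /bij_surj spec_surj; apply: inj_surj_bij.
  move=> y y' yy'; apply/closed_point_inj/spec_inj.
  by rewrite -!closed_point_map yy'.
move=> x; have [q qx] := spec_surj (closed_point x).
have [|y [yx _]] := @lying_over q x (spec_is_ideal q); last by exists y.
by move=> a; rewrite -[q _]/(spec_map pi q a) qx.
Qed.

Lemma comorphism_inj :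
  (forall x, exists y, point_map pi y = x) -> injective pi.
Proof.
move=> surj; apply: raddf_inj => a pia; apply: contrapT => /vpoint_nonzero[x].
by have [y <-] := surj x; rewrite /= pia rmorph0.
Qed.

Lemma spec_map_surj : injective pi -> forall p, exists q, spec_map pi q = p.
Proof.
move=> inj p; have [|q [_ qp]] := @going_up _ _ pi [set 0] p pi_int (is_ideal0 Y).
  by move=> a; rewrite -(rmorph0 pi) => /inj ->; exact: spec0.
by exists q.
Qed.

Hypothesis pi_inj : injective (point_map pi).

(** If [b] is in [q] but not in [q'], some point [y'] of the zero locus of [q'] has [b] nonzero. Its
    image lifts to the zero locus of [q], and by injectivity on points the lift is [y'], where [b]
    would vanish. *)
Lemma spec_map_inj : injective (spec_map pi).
Proof.
suff sub q q' : spec_map pi q = spec_map pi q' -> forall b, q b -> q' b.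
  by move=> q q' qq'; apply: spec_ext => b; split; apply: sub.
move=> qq' b qb; apply: contrapT => /nullstellensatz_prime[y' [yq' y'b]].
have [|y [yy' yq]] := @lying_over q (point_map pi y') (spec_is_ideal q).
  move=> a qa /=; apply: yq'.
  by rewrite -[q' _]/(spec_map pi q' a) -qq'.
by apply: y'b; rewrite -(pi_inj yy'); exact: yq.
Qed.

Lemma fraction_mod_spec (q : spec Y) (b : Y) :
  exists s a, ~ q (pi s) /\ q (pi s * b - pi a).
Proof.
apply: (fraction_mod_prime q b (comorphism_cst pi) pi_int) => y y' yy'.
by apply/pi_inj/vpoint_ext.
Qed.

Lemma residue_map_bij (q : spec Y) : bijective (@residue_map _ _ pi q).
Proof.
apply: inj_surj_bij; first exact: fmorph_inj.
elim/quotW=> u; set b := (val u).1; set t := (val u).2.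
have [s1 [a1 [qs1 qa1]]] := fraction_mod_spec q b.
have [s2 [a2 [qs2 qa2]]] := fraction_mod_spec q t.
(* Modulo [q], [b = a1 / s1] and [t = a2 / s2], so the preimage of [b / t] is [a1 * s2 / (s1 * a2)];
   its denominator must be outside the prime. *)
have pa2 : ~ comap pi q a2.
  move=> /= q_a2; apply: (spec_mulN qs2 (@resfracP _ _ u)).
  by rewrite -/t -[_ * t](subrK (pi a2)); exact: specD.
have pd : ~ comap pi q (s1 * a2) by exact: spec_mulN.
exists (\pi_(residue_field (comap pi q)) (mk_resfrac (a1 * s2) pd)).
rewrite residue_mapE; apply/resfracE => /=; rewrite -/b -/t !rmorphM.
have := specD (specMl (- (pi s2 * t)) qa1) (specMl (b * pi s1) qa2).
by congr (q _); ring.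
Qed.

Lemma subintegral_of_point_map_bij :
  (forall x, exists y, point_map pi y = x) -> subintegral pi.
Proof.
move=> surj; have inj := comorphism_inj surj; split=> //.
  by apply: inj_surj_bij; [exact: spec_map_inj|exact: spec_map_surj].
exact: residue_map_bij.
Qed.

Lemma zariski_homeomorphism : (forall x, exists y, point_map pi y = x) ->
  homeomorphism (point_map pi : zariski Y -> zariski X).
Proof.
move=> /(inj_surj_bij pi_inj)[g piK gK]; exists g; split=> //.
  apply/continuousP => U /zariski_openP[S ->]; apply/zariski_openP.
  exists [set pi a | a in S]; apply/seteqP; split=> y /= [].
    by move=> a Sa ya; exists (pi a) => //; exists a.
  by move=> _ [a Sa <-] ya; exists a.
apply/continuousP => U /zariski_openP[S ->]; apply/zariski_openP.
pose Z : set (vpoint Y) := [set y | forall b, S b -> y b = 0].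
(* The image of the closed set [Z] is cut out by the functions whose pullback vanishes on [Z]: lying
   over for the vanishing ideal of [Z] lifts their common zeros into [Z]. *)
exists [set a | forall y, Z y -> y (pi a) = 0].
apply/seteqP; split=> x /= [].
  move=> b Sb gxb; apply: contrapT => xT.
  pose I := [set b | forall y, Z y -> y b = 0].
  have [|a Ia|y [yx yI]] := @lying_over I x.
  - split=> [y _|a a' Ia Ia' y Zy|a a' Ia' y Zy]; first exact: rmorph0.
      by rewrite rmorphD Ia // Ia' // addr0.
    by rewrite rmorphM Ia' // mulr0.
  - by apply: contrapT => xa; apply: xT; exists a.
  by apply: gxb; rewrite -yx piK; apply: yI => y' Zy'; exact: Zy'.
move=> a Ta xa; apply: contrapT => gxS; apply: xa.
rewrite -(gK x); apply: Ta => b Sb; apply: contrapT => gxb; apply: gxS.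
by exists b.
Qed.

Lemma spec_homeomorphism : (forall x, exists y, point_map pi y = x) ->
  homeomorphism (spec_map pi).
Proof.
move=> /comorphism_inj inj.
have [g piK gK] := inj_surj_bij spec_map_inj (spec_map_surj inj).
exists g; split=> //.
  apply/continuousP => _ [S ->]; exists [set pi a | a in S].
  apply/seteqP; split=> q /= qS S0; apply: qS => b; last first.
    by move=> [a Sa <-]; exact: S0.
  by move=> Sb; apply: S0; exists b.
apply/continuousP => _ [S ->].
(* Closedness again, by going up for the intersection of the primes of [Z]. *)
pose Z := [set q : spec Y | forall b, S b -> q b].
exists [set a | forall q, Z q -> q (pi a)].
apply/seteqP; split=> p /= pS pS'; apply: pS => b Sb.
  pose I := [set b | forall q : spec Y, Z q -> q b].
  have [|a Ia|q [Iq qp]] := @going_up _ _ pi I p pi_int.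
  - split=> [q _|a a' Ia Ia' q Zq|a a' Ia' q Zq]; first exact: spec0.
      by apply: specD; [exact: Ia|exact: Ia'].
    by apply: specMl; exact: Ia'.
  - exact: pS'.
  rewrite -qp -[comap pi q]/(spec_map pi q) piK; apply: Iq => q' Zq'; exact: Zq'.
by rewrite -(gK p); exact: Sb.
Qed.

End FiniteMorphism.

(** * Euclidean topology *)

Lemma monic_root_bound (F : numDomainType) (n : nat) (c : 'I_n -> F) (z : F) :
  z ^+ n + \sum_(i < n) c i * z ^+ i = 0 -> `|z| <= 1 + \sum_(i < n) `|c i|.
Proof.
(* The order of [F] is partial: a negated inequality can be reversed only between real elements. *)
move=> zE; have realS : 1 + \sum_(i < n) `|c i| \is Num.real.
  by rewrite rpredD ?rpred1 // rpred_sum // => i _; exact: normr_real.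
rewrite real_leNgt ?normr_real //; apply/negP => zS.
have z1 : 1 <= `|z|.
  by apply: le_trans (ltW zS); rewrite lerDl sumr_ge0.
case: n c zE zS {realS} => [c|n c] zE zS.
  by move/eqP: zE; rewrite big_ord0 addr0 expr0 oner_eq0.
have : `|z| ^+ n.+1 <= (\sum_i `|c i|) * `|z| ^+ n.
  rewrite -normrX -[z ^+ _]addr0 -[X in _ + X](subrr (\sum_i c i * z ^+ i)).
  rewrite addrA zE sub0r normrN mulr_suml (le_trans (ler_norm_sum _ _ _)) //.
  apply: ler_sum => i _; rewrite normrM normrX ler_wpM2l //.
  by rewrite ler_weXn2l // -ltnS.
rewrite exprS ler_pM2r ?exprn_gt0 ?(lt_le_trans ltr01) // => zS'.
have := lt_le_trans zS zS'.
by rewrite real_ltNge ?lerDr ?ler01 // ?rpredD ?rpred1 // rpred_sum // => i _;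
  exact: normr_real.
Qed.

Section Euclidean.
Variables (R : realType) (X : affine_variety R).

Lemma vpoint_eval_continuous (a : X) :
  continuous ((fun x : vpoint X => x a) : euclidean X -> R[i]).
Proof.
pose S : set X :=
  [set a | continuous ((fun x : vpoint X => x a) : euclidean X -> R[i])].
suff ST : S = setT by have : setT a by []; rewrite -ST.
apply: coord_generated => [c|i|b c Sb Sc|b c Sb Sc].
- rewrite /S /= (_ : (fun x => _) = cst c); first exact: cst_continuous.
  by apply/funext => x; rewrite eval_cst.
- have E : (fun x : vpoint X => x (coord_gen i)) =
      (fun M : 'rV[R[i]]_(embdim X) => M ord0 i) \o @coords R X.
    by apply/funext => x; rewrite /= mxE.
  rewrite /S /= E => x; apply: continuous_comp; last exact: coord_continuous.
  exact: initial_continuous.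
- rewrite /S /= (_ : (fun x => _) = fun x : vpoint X => x b + x c).
    by move=> x; exact: (cvgD (Sb x) (Sc x)).
  by apply/funext => x; rewrite rmorphD.
- rewrite /S /= (_ : (fun x => _) = fun x : vpoint X => x b * x c).
    by move=> x; exact: (cvgM (Sb x) (Sc x)).
  by apply/funext => x; rewrite rmorphM.
Qed.

Lemma continuous_to_euclidean (T : topologicalType) (f : T -> vpoint X) :
  (forall a, continuous (fun t => f t a : R[i])) ->
  continuous (f : T -> euclidean X).
Proof.
move=> fa; apply: continuous_comp_initial => t U [P tP PU].
have : \forall s \near t, forall ij : 'I_1 * 'I_(embdim X),
    P ij.1 ij.2 (coords (f s) ij.1 ij.2).
  apply: filter_forall => -[i j]; have := tP i j.
  rewrite mxE => /(fa (coord_gen j) t); rewrite nbhs_simpl /=.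
  by apply: filterS => s; rewrite mxE.
rewrite nbhs_simpl /=; apply: filterS => s Ps; apply: PU => i j.
exact: (Ps (i, j)).
Qed.

End Euclidean.

Arguments vpoint_eval_continuous {R X} a.

Section FiniteEuclidean.
Variables (R : realType) (Y X : affine_variety R) (pi : variety_morphism Y X).

Lemma point_map_continuous :
  continuous (point_map pi : euclidean Y -> euclidean X).
Proof. by apply: continuous_to_euclidean => a; exact: vpoint_eval_continuous. Qed.

Hypothesis pi_finite : finite_morphism pi.
Let pi_int : integral_hom pi := module_finite_integral pi_finite.

Variable g : vpoint X -> vpoint Y.
Hypothesis gK : cancel g (point_map pi).

Let g_pi x a : g x (pi a) = x a.
Proof. by rewrite -{2}(gK x). Qed.

(** [g x b] is a root of a monic polynomial whose coefficients [x (c i)] are continuous in [x],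
    hence bounded near [x0]. *)
Lemma inverse_locally_bounded (b : Y) (x0 : vpoint X) :
  exists2 M : R[i], 0 <= M &
    \forall x \near (x0 : euclidean X), `|g x b| <= M.
Proof.
have [n [c bE]] := pi_int b.
exists (1 + \sum_(i < n) (`|x0 (c i)| + 1)).
  by rewrite addr_ge0 // sumr_ge0 // => i _; rewrite addr_ge0.
have : \forall x \near (x0 : euclidean X), forall i,
    `|(x : vpoint X) (c i)| < `|x0 (c i)| + 1.
  apply: (@filter_forall _ _ _ _ (nbhs_filter (x0 : euclidean X))) => i.
  by apply: (cvgr_norm_lt _ (vpoint_eval_continuous (c i) x0)); rewrite ltrDl.
apply: (@filterS _ _ (nbhs_filter (x0 : euclidean X))) => x cx.
have := @monic_root_bound _ n (fun i => x (c i)) (g x b).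
have := congr1 (g x) bE; rewrite rmorphD rmorphXn rmorph_sum rmorph0 => gE.
move=> /(_ _)/le_trans; apply.
  rewrite -[RHS]gE; congr (_ + _); apply: eq_bigr => i _.
  by rewrite rmorphM rmorphXn /= g_pi.
by rewrite lerD2l; apply: ler_sum => i _; exact: ltW.
Qed.

Hypothesis pi_inj : injective (point_map pi).

(* The point over [x0] is unique, so by the Nullstellensatz the ideal it
   generates in C[Y] has the maximal ideal of [g x0] as its radical. *)
Lemma power_in_fiber_ideal (m : nat) (e : 'I_m -> Y) (x0 : vpoint X) (t : Y) :
    (forall b, exists c : 'I_m -> X, b = \sum_i pi (c i) * e i) ->
    g x0 t = 0 ->
  exists N (a : 'I_m -> X), (forall i, x0 (a i) = 0) /\
    t ^+ N.+1 = \sum_i pi (a i) * e i.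
Proof.
move=> span_e gt; pose I : set Y :=
  [set b | exists a : 'I_m -> X, (forall i, x0 (a i) = 0) /\
     b = \sum_i pi (a i) * e i].
have /boolp.choice[d dE] : forall u : Y * 'I_m, exists c : 'I_m -> X,
    u.1 * e u.2 = \sum_j pi (c j) * e j by move=> u; exact: span_e.
have Iid : is_ideal I.
  split=> [|b b' [a [xa ->]] [a' [xa' ->]]|b b' [a [xa ->]]].
  - exists (fun=> 0); split=> [i|]; first exact: rmorph0.
    by rewrite big1 // => i _; rewrite rmorph0 mul0r.
  - exists (fun i => a i + a' i); split=> [i|].
      by rewrite rmorphD xa xa' addr0.
    by rewrite -big_split; apply: eq_bigr => i _; rewrite rmorphD mulrDl.
  - exists (fun j => \sum_i a i * d (b, i) j); split=> [j|].
      by rewrite rmorph_sum big1 // => i _; rewrite rmorphM xa mul0r.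
    rewrite mulr_sumr.
    under eq_bigr => i _ do rewrite mulrCA (dE (b, i)) mulr_sumr.
    rewrite exchange_big; apply: eq_bigr => j _.
    by rewrite rmorph_sum mulr_suml; apply: eq_bigr => i _; rewrite rmorphM mulrA.
have [[N IN]|/forallNP nI] := pselect (exists N, I (t ^+ N)).
  (* One more factor [t] makes the exponent positive, as the comparison of powers in
     [inverse_continuous] needs. *)
  have [_ _ IM] := Iid; have [a [xa tE]] := IM t _ IN.
  by exists N, a; rewrite exprS.
(* Since [I] contains the image of the maximal ideal of [x0], [y] lies over [x0], so it is [g x0],
   where [t] vanishes. *)
have [y [yI yt]] := nullstellensatz Iid nI.
case: yt; rewrite (_ : y = g x0) //; apply: pi_inj; rewrite gK.
apply: vpoint_ext => a /=.
have : y (pi (a - coord_cst X (x0 a))) = 0.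
  apply: yI; have [c cE] := span_e 1.
  exists (fun i => (a - coord_cst X (x0 a)) * c i); split=> [i|].
    by rewrite rmorphM rmorphB eval_cst subrr mul0r.
  rewrite -[LHS]mulr1 cE mulr_sumr.
  by apply: eq_bigr => i _; rewrite rmorphM mulrA.
by rewrite !rmorphB comorphism_cst eval_cst => /eqP; rewrite subr_eq0 => /eqP.
Qed.

Lemma inverse_continuous : continuous (g : euclidean X -> euclidean Y).
Proof.
apply: continuous_to_euclidean => b x0.
pose t := b - coord_cst Y (g x0 b).
have tE x : g x b - g x0 b = g x t by rewrite /t rmorphB eval_cst.
have [m [e span_e]] := pi_finite.
have gt : g x0 t = 0 by rewrite -tE subrr.
have [N [a [xa tN]]] := power_in_fiber_ideal span_e gt.
have /boolp.choice[M MP] : forall i, exists M : R[i], 0 <= M /\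
    \forall x \near (x0 : euclidean X), `|g x (e i)| <= M.
  by move=> i; have [M M0 MP] := inverse_locally_bounded (e i) x0; exists M.
apply/(@cvgrPdist_lt _ _ _ _ (nbhs_filter (x0 : euclidean X))) => eps eps0.
(* If each [x (a i)] is below [eps ^+ N.+1 / K], then [g x t ^+ N.+1] is at most [eps ^+ N.+1] times
   the sum of the [M i] over [K]; the added 1 makes this ratio less than 1. *)
pose K := 1 + \sum_i M i.
have K0 : 0 < K by rewrite ltr_pwDl // sumr_ge0 // => i _; exact: (MP i).1.
have d0 : 0 < eps ^+ N.+1 / K by rewrite divr_gt0 // exprn_gt0.
have near_a : \forall x \near (x0 : euclidean X), forall i,
    `|(x : vpoint X) (a i)| < eps ^+ N.+1 / K.
  apply: (@filter_forall _ _ _ _ (nbhs_filter (x0 : euclidean X))) => i.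
  apply: (cvgr_norm_lt _ (vpoint_eval_continuous (a i) x0)).
  by rewrite xa normr0.
have near_e : \forall x \near (x0 : euclidean X), forall i, `|g x (e i)| <= M i.
  apply: (@filter_forall _ _ _ _ (nbhs_filter (x0 : euclidean X))) => i.
  exact: (MP i).2.
apply: (@filterS2 _ _ (nbhs_filter (x0 : euclidean X)) _ _ _ _ near_a near_e).
move=> x ax ex.
rewrite distrC tE -(@ltr_pXn2r _ N.+1) ?nnegrE ?(ltW eps0) // -normrX -rmorphXn.
rewrite tN rmorph_sum (le_lt_trans (ler_norm_sum _ _ _)) //.
apply: (@le_lt_trans _ _ (\sum_i eps ^+ N.+1 / K * M i)).
  apply: ler_sum => i _; rewrite rmorphM normrM /= g_pi.
  by apply: ler_pM => //; exact: ltW.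
by rewrite -mulr_sumr -mulrA gtr_pMr ?exprn_gt0 // ltr_pdivrMl // mulr1 ltrDr.
Qed.

End FiniteEuclidean.

(** * Rational continuous functions *)

(** [q] is the complement of a maximal multiplicative set [S] containing [h] but not 0. Adjoining to
    [S] the powers of some [z] outside it must produce 0, which gives the second clause: a relation
    modulo [q] becomes a true one, up to a power, on a set where some [t] outside [q] is nonzero. *)
Lemma generic_prime (A : comPzRingType) (h : A) : (forall n, h ^+ n <> 0) ->
  exists q : spec A, ~ q h /\
    forall z, q z -> exists t n, ~ q t /\ t * z ^+ n = 0.
Proof.
move=> h_nilp.
pose mult := [set S : set A |
  [/\ S h, S 1, forall a b, S a -> S b -> S (a * b) & ~ S 0]].
pose P : set (set A) := [set S | S = set0 \/ mult S].
have [F FP Ftot|S [[->|[Sh S1 SM S0]] Smax]] := @Zorn_bigcup A P.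
- have multF K b : F K -> K b -> mult K.
    by move=> FK Kb; have [K0|//] := FP _ FK; rewrite K0 in Kb.
  have [[K [FK [k Kk]]]|F0] := pselect (exists K, F K /\ K !=set0); last first.
    left; apply/seteqP; split=> // a [K FK Ka]; apply: F0.
    by exists K; split=> //; exists a.
  right; have [Kh K1 _ _] := multF _ _ FK Kk; split.
  + by exists K.
  + by exists K.
  + move=> a b [L FL La] [M FM Mb]; have [LM|ML] := Ftot _ _ FL FM.
      exists M => //; have [_ _ MM _] := multF _ _ FM Mb.
      by apply: MM => //; exact: LM.
    exists L => //; have [_ _ LL _] := multF _ _ FL La.
    by apply: LL => //; exact: ML.
  + by move=> [L FL L0]; have [_ _ _] := multF _ _ FL L0; exact.
- exfalso; apply: (Smax [set a | exists n, a = h ^+ n]).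
    split=> // /(_ 1); apply; by exists 0%N.
  right; split; [by exists 1%N|by exists 0%N| |].
    by move=> a b [m ->] [n ->]; exists (m + n)%N; rewrite exprD.
  by move=> [n /esym]; exact: h_nilp.
have S_kill z : ~ S z -> exists t n, S t /\ t * z ^+ n = 0.
  move=> Sz; apply: contrapT => nkill.
  pose K := [set a | exists t n, S t /\ a = t * z ^+ n].
  have SK a : S a -> K a by exists a, 0%N; rewrite expr0 mulr1.
  apply: (Smax K); first split=> //.
    by move=> KS; apply: Sz; apply: KS; exists 1, 1%N; rewrite mul1r.
  right; split; [exact: SK|exact: SK| |].
    move=> _ _ [t [n [St ->]]] [t' [n' [St' ->]]].
    exists (t * t'), (n + n')%N; split; first exact: SM.
    by rewrite exprD mulrACA.
  by move=> [t [n [St /esym tz]]]; apply: nkill; exists t, n.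
(* Each binomial term of [(a + b) ^+ (m + n)] contains [a ^+ m] or [b ^+ n], so [t * t'] kills
   it. *)
have SD a b : ~ S a -> ~ S b -> ~ S (a + b).
  move=> /S_kill[t [m [St ta]]] /S_kill[t' [n [St' tb]]] Sab; apply: S0.
  have SX k : S ((a + b) ^+ k).
    by elim: k => // k IHk; rewrite exprS; exact: SM.
  have <- : t * t' * (a + b) ^+ (m + n) = 0; last exact/SM/SX/SM.
  rewrite exprDn mulr_sumr big1 // => i _; rewrite mulrnAr.
  have [im|/ltnW im] := leqP i n.
    rewrite -addnBA // exprD.
    have -> : t * t' * (a ^+ m * a ^+ (n - i) * b ^+ i) =
      t * a ^+ m * (t' * a ^+ (n - i) * b ^+ i) by ring.
    by rewrite ta mul0r mul0rn.
  rewrite -(subnK im) exprD.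
  have -> : t * t' * (a ^+ (m + n - (i - n + n)) * (b ^+ (i - n) * b ^+ n)) =
    t' * b ^+ n * (t * a ^+ (m + n - (i - n + n)) * b ^+ (i - n)) by ring.
  by rewrite tb mul0r mul0rn.
have SMl a b : ~ S b -> ~ S (a * b).
  move=> /S_kill[t [n [St tb]]] Sab; apply: S0.
  have SX k : S ((a * b) ^+ k).
    by elim: k => // k IHk; rewrite exprS; exact: SM.
  have <- : t * (a * b) ^+ n = 0; last exact: SM.
  by rewrite exprMn mulrCA tb mulr0.
have Sprime a b : ~ S (a * b) -> ~ S a \/ ~ S b.
  move=> Sab; apply: contrapT => /not_orP[/contrapT Sa /contrapT Sb].
  by apply: Sab; exact: SM.
exists (@Spec _ (fun a => ~ S a) S0 SD SMl (fun nS1 => nS1 S1) Sprime).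
split=> [/(_ Sh)//|z /= /S_kill[t [n [St tz]]]].
by exists t, n; split=> // /(_ St).
Qed.

Section RationalContinuous.
Variables (R : realType) (Y X : affine_variety R) (pi : variety_morphism Y X).

Lemma eval_K0 (a : X) : (fun x : vpoint X => x a) \in @K0_pred R X.
Proof.
apply/asboolP; split; last exact: (vpoint_eval_continuous a).
exists setT; split; [exact: openT|by move=> O O0 _; rewrite setIT|].
move=> x _; exists a, 1, setT; split=> // [|y _]; first exact: openT.
by rewrite rmorph1 oner_eq0 divr1.
Qed.

Hypothesis pi_finite : finite_morphism pi.
Let pi_int : integral_hom pi := module_finite_integral pi_finite.

Variable g : vpoint X -> vpoint Y.
Hypothesis piK : cancel (point_map pi) g.
Hypothesis gK : cancel g (point_map pi).
Let pi_inj : injective (point_map pi) := can_inj piK.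
Hypothesis pi_cont : continuous (point_map pi : zariski Y -> zariski X).
Hypothesis g_cont : continuous (g : zariski X -> zariski Y).

Lemma K0_comp (f : vpoint X -> R[i]) :
  f \in @K0_pred R X -> f \o point_map pi \in @K0_pred R Y.
Proof.
move=> /asboolP[[U [oU dU fU]] fc]; apply/asboolP; split; last first.
  move=> y; apply: (@continuous_comp (euclidean Y) (euclidean X)).
    exact: point_map_continuous.
  exact: fc.
have pre (W : set (zariski X)) :
    open W -> open (point_map pi @^-1` W : set (zariski Y)).
  by move: W; apply/continuousP.
exists (point_map pi @^-1` U); split; first exact: pre.
  (* Density is carried through [g], whose Zariski continuity makes the preimage of [O] open. *)
  move=> O [y Oy] oO; have [||x [Ox Ux]] := dU (g @^-1` O).
  - by exists (point_map pi y); rewrite /= piK.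
  - by move/continuousP: g_cont; exact.
  by exists (g x); split=> //=; rewrite gK.
move=> y /fU[a [b [W [oW Wy WU fW]]]].
exists (pi a), (pi b), (point_map pi @^-1` W); split=> //.
- exact: pre.
- by move=> z /WU.
- by move=> z /fW.
Qed.

(* Near a generic point of [Y] both numerator and denominator of [f] are
   fractions of elements of C[X]. *)
Lemma rational_inverse_comp (f : vpoint Y -> R[i]) :
  is_rational f -> is_rational (f \o g).
Proof.
move=> [U [oU dU fU]].
(* The union of all open sets on which [f \o g] is a single fraction; its density is what needs an
   argument. *)
pose good := [set W : set (zariski X) | open W /\ exists a b : X,
  forall x : vpoint X, W x -> x b != 0 /\ f (g x) = x a / x b].
exists (\bigcup_(W in good) W); split.
- by apply: bigcup_open => W [].
- move=> O [x Ox] oO.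
  have oO' : open (point_map pi @^-1` O : set (zariski Y)).
    by move/continuousP: pi_cont; exact.
  have [|y [Oy Uy]] := dU (point_map pi @^-1` O) _ oO'.
    by exists (g x); rewrite /= gK.
  have [a [b [W [oW Wy _ fW]]]] := fU y Uy.
  have /zariski_openP[S WOE] := openI oW oO'.
  have [s Ss ys] : exists2 s, S s & (y : vpoint Y) s <> 0.
    by have : (W `&` (point_map pi @^-1` O)) y by []; rewrite WOE.
  have sub (z : vpoint Y) : z s <> 0 -> W z /\ O (point_map pi z).
    move=> zs; have : (W `&` (point_map pi @^-1` O)) z.
      by rewrite WOE; exists s.
    by [].
  (* [s] cuts out a neighbourhood of [y] inside [W] and over [O], and [s * b] is not nilpotent,
     being nonzero at [y]. *)
  have [|q [qh q_kill]] := @generic_prime Y (s * b).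
    move=> n /(congr1 (y : vpoint Y)); rewrite rmorphXn rmorph0 rmorphM.
    have [/eqP yb _] := fW _ Wy.
    by move=> /eqP; rewrite expf_eq0 mulf_eq0 => /andP[_ /orP[]/eqP].
  have [s1 [a1 [qs1 qa]]] := fraction_mod_spec pi_int pi_inj q a.
  have [s2 [a2 [qs2 qb]]] := fraction_mod_spec pi_int pi_inj q b.
  have [t1 [n1 [qt1 t1E]]] := q_kill _ qa.
  have [t2 [n2 [qt2 t2E]]] := q_kill _ qb.
  (* Where [H] is nonzero, the relations for [a] and [b] modulo [q] hold exactly, with nonzero
     denominators. *)
  pose H := s * b * (pi s1 * pi s2 * (t1 * t2)).
  have [z [_ zH]] : exists z : vpoint Y, (forall t, q t -> z t = 0) /\ z H <> 0.
    apply: nullstellensatz_prime.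
    exact: spec_mulN qh (spec_mulN (spec_mulN qs1 qs2) (spec_mulN qt1 qt2)).
  have HE (x' : vpoint X) : g x' H <> 0 -> [/\ g x' s <> 0, x' (s1 * a2) != 0 &
      g x' a / g x' b = x' (a1 * s2) / x' (s1 * a2)].
    move=> /eqP; rewrite !rmorphM !mulf_eq0 !negb_or.
    move=> /and3P[/andP[xs xb] /andP[xs1 xs2] /andP[xt1 xt2]].
    have g_pi c : g x' (pi c) = x' c by rewrite -{2}(gK x').
    have frac t n c s' c' : g x' t != 0 -> t * (pi s' * c - pi c') ^+ n = 0 ->
        x' s' * g x' c = x' c'.
      move=> xt /(congr1 (g x')) /eqP; rewrite rmorphM rmorph0 mulf_eq0.
      rewrite (negPf xt) rmorphXn expf_eq0 rmorphB rmorphM /= !g_pi subr_eq0.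
      by move=> /andP[_ /eqP].
    have aE := frac _ _ _ _ _ xt1 t1E; have bE := frac _ _ _ _ _ xt2 t2E.
    rewrite !g_pi in xs1 xs2.
    rewrite -aE -bE; split; [exact/eqP|by rewrite xs1 mulf_neq0|].
    rewrite [x' s1 * _ * _]mulrAC (mulrA (x' s1)) -mulf_div divff ?mul1r //.
    exact: mulf_neq0.
  exists (point_map pi z); split.
    have zH' : g (point_map pi z) H <> 0 by rewrite piK.
    have [zs _ _] := HE _ zH'.
    by rewrite piK in zs; have [] := sub _ zs.
  exists (g @^-1` [set y | y H <> 0]).
    split.
      move/continuousP: g_cont; apply; apply/zariski_openP.
      exists [set H]; apply/seteqP; split=> y' /=; first by exists H.
      by move=> [_ ->].
    exists (a1 * s2), (s1 * a2) => x' /HE[xs xd <-]; split=> //.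
    by have [Wx _] := sub _ xs; have [] := fW _ Wx.
  by rewrite /= piK.
move=> x [W [oW [a [b fW]]] Wx]; exists a, b, W; split=> //.
by move=> x' Wx'; exists W => //; split=> //; exists a, b.
Qed.

Lemma K0_inverse_comp (f : vpoint Y -> R[i]) :
  f \in @K0_pred R Y -> f \o g \in @K0_pred R X.
Proof.
move=> /asboolP[fr fc]; apply/asboolP; split.
  exact: rational_inverse_comp.
move=> x; apply: (@continuous_comp (euclidean X) (euclidean Y)).
  exact: (inverse_continuous pi_finite gK pi_inj).
exact: fc.
Qed.

Definition K0_pullback (f : K0 X) : K0 Y := MkK0 (K0_comp (valP f)).

Lemma K0_pullback_zmod_morphism : zmod_morphism K0_pullback.
Proof. by move=> f h; apply: val_inj. Qed.

Lemma K0_pullback_monoid_morphism : monoid_morphism K0_pullback.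
Proof. by split=> [|f h]; apply: val_inj. Qed.

Lemma K0_pullback_iso : exists Phi : {rmorphism K0 X -> K0 Y}, bijective Phi /\
  forall (f : K0 X) (y : vpoint Y), Phi f y = f (point_map pi y).
Proof.
pose Phi := HB.pack_for {rmorphism K0 X -> K0 Y} K0_pullback
  (GRing.isZmodMorphism.Build _ _ K0_pullback K0_pullback_zmod_morphism)
  (GRing.isMonoidMorphism.Build _ _ K0_pullback K0_pullback_monoid_morphism).
exists Phi; split=> //.
exists (fun f => MkK0 (K0_inverse_comp (valP f))) => f; apply: val_inj => /=.
  by apply/funext => x /=; rewrite gK.
by apply/funext => y /=; rewrite piK.
Qed.

End RationalContinuous.

(** Regular functions separate the points of [Y], and by surjectivity of [Phi] they are constant on
    the fibres. By injectivity of [Phi], a function in the kernel of [pi] vanishes at every [x], so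
    lying over applies with the zero ideal. *)
Lemma point_map_bij_of_K0_iso (R : realType) (Y X : affine_variety R)
    (pi : variety_morphism Y X) (Phi : {rmorphism K0 X -> K0 Y}) :
    integral_hom pi -> bijective Phi ->
    (forall (f : K0 X) (y : vpoint Y), Phi f y = f (point_map pi y)) ->
  bijective (point_map pi).
Proof.
move=> pi_int /[dup] /bij_inj Phi_inj /bij_surj Phi_surj PhiE.
apply: inj_surj_bij => [y y' yy'|x].
  apply: vpoint_ext => b; have [f fE] := Phi_surj (MkK0 (eval_K0 b)).
  rewrite -[y b]/(MkK0 (eval_K0 b) y) -[y' b]/(MkK0 (eval_K0 b) y') -fE.
  by rewrite !PhiE yy'.
have [a pia|y [yx _]] := @lying_over _ _ _ pi pi_int _ x (is_ideal0 Y);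
  last by exists y.
have : MkK0 (eval_K0 a) = 0 :> K0 X.
  apply: Phi_inj; rewrite rmorph0; apply: val_inj; apply/funext => y /=.
  by rewrite PhiE /= pia rmorph0.
by move=> /(congr1 (fun f : K0 X => f x)).
Qed.

Theorem mainTheorem1 (R : realType) (Y X : affine_variety R)
    (pi : variety_morphism Y X) (pi_finite : finite_morphism pi) :
  [<-> subintegral pi;
       bijective (point_map pi);
       exists Phi : {rmorphism K0 X -> K0 Y}, bijective Phi /\
         forall (f : K0 X) (y : vpoint Y), Phi f y = f (point_map pi y);
       homeomorphism (point_map pi : euclidean Y -> euclidean X);
       homeomorphism (point_map pi : zariski Y -> zariski X);
       homeomorphism (spec_map pi)].
Proof.
have pi_int : integral_hom pi := module_finite_integral pi_finite.
tfae.
- by move=> [_ _ spec_bij _]; exact: point_map_bij_of_spec_map.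
- move=> /[dup] /bij_inj inj /bij_surj surj.
  have [g [piK gK pi_cont g_cont]] := zariski_homeomorphism pi_int inj surj.
  exact: (K0_pullback_iso pi_finite piK gK pi_cont g_cont).
- move=> [Phi [Phi_bij PhiE]].
  have [g piK gK] := point_map_bij_of_K0_iso pi_int Phi_bij PhiE.
  exists g; split=> //; first exact: point_map_continuous.
  exact: (inverse_continuous pi_finite gK (can_inj piK)).
- move=> /homeomorphism_bij /[dup] /bij_inj inj /bij_surj surj.
  exact: zariski_homeomorphism.
- move=> /homeomorphism_bij /[dup] /bij_inj inj /bij_surj surj.
  exact: spec_homeomorphism.
- move=> /homeomorphism_bij /(point_map_bij_of_spec_map pi_int) bij.
  by apply: subintegral_of_point_map_bij => //; [exact: bij_inj|exact: bij_surj].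
Qed.
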